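(* Let $a\in\mathbb{Z}^d_+$ and let $\Lambda=(0,\infty)^d$, regarded as a measurable space with its Borel sets. For each $\lambda\in\Lambda$ let $R_\lambda(x)$ be a real trigonometric polynomial with degree less than $a$. Let $\nu$ be a non-negative measure on $\Lambda$ that satisfies $$\int_\Lambda\int_{\mathbb{T}^d}|R_\lambda(x)-f_\lambda(x)|\,dx\,d\nu(\lambda)<\infty.\qquad(\ast)$$ Suppose that $g:\mathbb{T}^d\to\mathbb{R}$ is a continuous periodic function such that $$\hat g(k)=\int_\Lambda\hat G_\lambda(k)\,d\nu(\lambda)$$ for all $k\in\mathbb{Z}^d$ such that $|k_j|\ge a_j$ for some $j\in\{1,\dots,d\}$. Then: (i) if $f_\lambda(x)\le R_\lambda(x)$ for each $x\in\mathbb{T}^d$ and $\lambda\in\Lambda$, then there exists a trigonometric polynomial $m_a$ of degree less than $a$ such that $m_a(x)\ge g(x)$ for all $x\in\mathbb{T}^d$ and $\int_{\mathbb{T}^d}\{m_a(x)-g(x)\}\,dx$ is equal to the left-hand side of $(\ast)$; (ii) if $R_\lambda(x)\le f_\lambda(x)$ for each $x\in\mathbb{T}^d$ and $\lambda\in\Lambda$, then there exists a trigonometric polynomial $l_a$ of degree less than $a$ such that $l_a(x)\le g(x)$ for all $x\in\mathbb{T}^d$ and $\int_{\mathbb{T}^d}\{g(x)-l_a(x)\}\,dx$ is equal to the left-hand side of $(\ast)$.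
   Context: Notation: $\mathbb{T}^d=\mathbb{R}^d/\mathbb{Z}^d$; $\mathbb{Z}^d_+$ is the set of $a\in\mathbb{Z}^d$ with $a_j\ge1$ for all $j$. A trigonometric polynomial $P$ has degree less than $a$ if $P(x)=\sum_{-a<n<a}\hat P(n)e^{2\pi i n\cdot x}$, where $-a<n<a$ means $n\in\mathbb{Z}^d$ and $|n_j|<a_j$ for all $j$. For $\lambda\in(0,\infty)^d$, $G_\lambda(x)=\prod_{j=1}^d e^{-\lambda_j\pi x_j^2}$ on $\mathbb{R}^d$, with Fourier transform $\hat G_\lambda(\xi)=\prod_{j=1}^d\lambda_j^{-1/2}e^{-\pi\xi_j^2/\lambda_j}$, and $f_\lambda(x)=\sum_{n\in\mathbb{Z}^d}G_\lambda(x+n)$ is its periodization. For $g$ on $\mathbb{T}^d$, $\hat g(k)=\int_{\mathbb{T}^d}g(x)e^{-2\pi i k\cdot x}\,dx$. *)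

(* Defs.v *)
From HB Require Import structures.
From mathcomp Require Import all_boot all_order all_algebra.
From mathcomp Require Import complex.
From mathcomp Require Import all_classical all_reals all_analysis.
From mathcomp Require Import measurable_realfun.

Set Implicit Arguments.
Unset Strict Implicit.
Unset Printing Implicit Defensive.
Import Order.TTheory GRing.Theory Num.Theory.
Import numFieldNormedType.Exports.
Local Open Scope classical_set_scope.
Local Open Scope ring_scope.
Local Open Scope complex_scope.

(* Lebesgue measure on R^n.  It lives on n-tuples, whose library sigma-algebra
   is the product (= Borel) one; the recursion is R^n.+1 = R * R^n. *)
Definition tcons (R : realType) n
    (p : measurableTypeR R * n.-tuple (measurableTypeR R)) :
  n.+1.-tuple (measurableTypeR R) := [the n.+1.-tuple _ of p.1 :: p.2].

Fixpoint lebn (R : realType) n : set (n.-tuple (measurableTypeR R)) -> \bar R :=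
  match n with
  | 0 => dirac [tuple]
  | m.+1 => pushforward (@lebesgue_measure R \x @lebn R m)%E (@tcons R m)
  end.
Arguments lebn : clear implicits.

Lemma measurable_tcons (R : realType) n : measurable_fun setT (@tcons R n).
Proof. exact: measurable_cons measurable_fst measurable_snd. Qed.

Lemma measurable_tuncons (R : realType) n :
  measurable_fun setT (fun t : n.+1.-tuple (measurableTypeR R) =>
    (thead t, [tuple of behead t] : n.-tuple (measurableTypeR R))).
Proof.
apply/measurable_fun_pairP; split.
- exact: (measurable_tnth ord0).
- exact: measurable_behead.
Qed.

Section lebn_step.
Context (R : realType) (n : nat).
Variable m : {sigma_finite_measure set (n.-tuple (measurableTypeR R)) -> \bar R}.

Let step := pushforward (@lebesgue_measure R \x m)%E (@tcons R n).

Let step0 : step set0 = 0%E.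
Proof. by rewrite /step /pushforward preimage_set0 measure0. Qed.

Let step_ge0 A : (0 <= step A)%E.
Proof. by rewrite /step /pushforward measure_ge0. Qed.

Let step_sigma_additive : semi_sigma_additive step.
Proof.
move=> F mF tF mUF; rewrite /step /pushforward preimage_bigcup.
apply: measure_semi_sigma_additive.
- by move=> k; rewrite -[X in measurable X]setTI; exact: measurable_tcons.
- apply/trivIsetP => /= i j _ _ ij; rewrite -preimage_setI.
  by move/trivIsetP : tF => /(_ _ _ _ _ ij) ->//; rewrite preimage_set0.
- by rewrite -preimage_bigcup -[X in measurable X]setTI; exact: measurable_tcons.
Qed.

HB.instance Definition _ := isMeasure.Build _ _ _ step
  step0 step_ge0 step_sigma_additive.

Let step_sigma_finite : sigma_finite setT step.
Proof.
have [F TF Foo] : sigma_finite setT (@lebesgue_measure R \x m)%E.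
  have /sigma_finiteP[F [TF ndF Foo]] := sigma_finiteT (@lebesgue_measure R).
  have /sigma_finiteP[G [TG ndG Goo]] := sigma_finiteT m.
  exists (fun k => F k `*` G k).
    rewrite -setXTT TF TG predeqE => -[x y]; split.
      move=> [/= [k _ Fkx] [l _ Gly]]; exists (maxn k l) => //; split.
      - by move: x Fkx; exact/subsetPset/ndF/leq_maxl.
      - by move: y Gly; exact/subsetPset/ndG/leq_maxr.
    by move=> [k _ []/= ? ?]; split; exists k.
  move=> k; have [? ?] := Foo k; have [? ?] := Goo k.
  split; first exact: measurableX.
  by rewrite product_measure1E// lte_mul_pinfty// ge0_fin_numE.
pose u (t : n.+1.-tuple (measurableTypeR R)) :=
  (thead t, [tuple of behead t] : n.-tuple (measurableTypeR R)).
have tconsK : cancel (@tcons R n) u.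
  by move=> [x y]; congr pair; apply/val_inj.
exists (fun k => u @^-1` F k).
  by rewrite -preimage_bigcup -TF preimage_setT.
move=> k; have [mFk Fkoo] := Foo k; split.
  by rewrite -[X in measurable X]setTI; exact: measurable_tuncons.
rewrite /step /pushforward -comp_preimage.
by rewrite (_ : u \o _ = id) ?preimage_id//; apply/funext => x /=; rewrite tconsK.
Qed.

HB.instance Definition _ := Measure_isSigmaFinite.Build _ _ _ step
  step_sigma_finite.

Lemma lebn_step : exists
    mu : {sigma_finite_measure set (n.+1.-tuple (measurableTypeR R)) -> \bar R},
  (mu : set _ -> \bar R) = pushforward (@lebesgue_measure R \x m)%E (@tcons R n).
Proof. by exists step. Qed.

End lebn_step.

Section lebn_measure.
Context (R : realType) (n : nat).

Let lebn_sfm : exists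
    mu : {sigma_finite_measure set (n.-tuple (measurableTypeR R)) -> \bar R},
  (mu : set _ -> \bar R) = lebn R n.
Proof.
elim: n => [|k [mu muE]]; first by exists (dirac [tuple]).
by have [nu nuE] := lebn_step mu; exists nu; rewrite nuE muE.
Qed.

Let lebn0 : lebn R n set0 = 0%E.
Proof. by have [mu <-] := lebn_sfm; rewrite measure0. Qed.

Let lebn_ge0 A : (0 <= lebn R n A)%E.
Proof. by have [mu <-] := lebn_sfm; exact: measure_ge0. Qed.

Let lebn_sigma_additive : semi_sigma_additive (lebn R n).
Proof. by have [mu <-] := lebn_sfm; exact: measure_semi_sigma_additive. Qed.

HB.instance Definition _ := isMeasure.Build _ _ _ (lebn R n)
  lebn0 lebn_ge0 lebn_sigma_additive.

Let lebn_sigma_finite : sigma_finite setT (lebn R n).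
Proof. by have [mu <-] := lebn_sfm; exact: sigma_finiteT. Qed.

HB.instance Definition _ := Measure_isSigmaFinite.Build _ _ _ (lebn R n)
  lebn_sigma_finite.

End lebn_measure.

Section torus.
Context (R : realType) (d : nat).
Implicit Types (x xi l : 'rV[R]_d) (k n a : 'rV[int]_d).

Definition zvec n : 'rV[R]_d := map_mx intr n.

(* Functions on the torus are Z^d-periodic functions on R^d. *)
Definition zperiodic (T : Type) (F : 'rV[R]_d -> T) : Prop :=
  forall x n, F (x + zvec n) = F x.

(* Integrals over the torus are integrals over its fundamental domain [0, 1[^d. *)
Definition unit_cube : set (d.-tuple (measurableTypeR R)) :=
  [set t | forall j, tnth t j \in `[0, 1[].

Definition torus_integral (F : 'rV[R]_d -> R) : \bar R :=
  (\int[lebn R d]_(t in unit_cube) (F (\row_j tnth t j))%:E)%E.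

Definition torus_Cintegral (F : 'rV[R]_d -> R[i]) : R[i] :=
  fine (torus_integral (fun x => complex.Re (F x)))
  +i* fine (torus_integral (fun x => complex.Im (F x))).

(* e^{2 pi i k.x} *)
Definition expi2pi k x : R[i] :=
  let t := 2 * pi * \sum_j (k ord0 j)%:~R * x ord0 j in cos t +i* sin t.

Definition fourier_coef (F : 'rV[R]_d -> R) k : R[i] :=
  torus_Cintegral (fun x => (F x)%:C * expi2pi (- k) x).

Definition freq_lt a : set 'rV[int]_d :=
  [set n | forall j, `|n ord0 j| < a ord0 j].

Definition trigpoly_lt a (P : 'rV[R]_d -> R) : Prop :=
  forall x, (P x)%:C = \sum_(n \in freq_lt a) fourier_coef P n * expi2pi n x.

(* A measure on Lambda is represented by a Borel measure on R^d that is only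
   ever integrated over Lambda. *)
Definition Lambda : set 'rV[R]_d := [set l | forall j, 0 < l ord0 j].

Definition borel_rV := g_sigma_algebraType (@open 'rV[R]_d).

Definition gauss l x : R :=
  \prod_j expR (- (l ord0 j * pi * x ord0 j ^+ 2)).

Definition gauss_hat l xi : R :=
  \prod_j ((Num.sqrt (l ord0 j))^-1 * expR (- (pi * xi ord0 j ^+ 2 / l ord0 j))).

(* The series has nonnegative terms; it converges for l in Lambda. *)
Definition gauss_periodization l x : R :=
  fine (\esum_(n in [set: 'rV[int]_d]) (gauss l (x + zvec n))%:E)%E.

Definition L1_error (P : 'rV[R]_d -> 'rV[R]_d -> R) l : \bar R :=
  torus_integral (fun x => `|P l x - gauss_periodization l x|).

Definition total_error (nu : {measure set borel_rV -> \bar R})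
    (P : 'rV[R]_d -> 'rV[R]_d -> R) : \bar R :=
  (\int[nu]_(l in Lambda) L1_error P l)%E.

End torus.
Arguments zvec {R d} n.
Arguments Lambda {R d}.

(* Main.v *)
(**
Let [s] be 1 in case (i) and -1 in case (ii), so that [D_l = s (R_l - f_l) >= 0].
If [h] is a continuous function on the torus whose Fourier coefficients are the
[nu]-integrals of those of [D_l], then for every nonnegative trigonometric
polynomial [T] the integral of [h T] is the [nu]-integral of that of [D_l T],
hence nonnegative; letting [T] concentrate at a point, [h >= 0].  At frequencies
outside [-a < n < a] the function [- s g] already has the required coefficients,
because the coefficients of [f_l] are the [gauss_hat l (zvec k)] and those of
[R_l] vanish.  So it suffices to add to it [s m], with [m] a trigonometric
polynomial of degree less than [a], and the mean of [h] is then the total error.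

The coefficients of [R_l] need not depend measurably on [l], so the integral over
[nu] is first extended to a positive linear functional on the span of the
integrable functions and of the finitely many coefficients of [D_l] of degree less
than [a]; they are dominated by the integrable function [L1_error].
*)
Require Import Defs.
From HB Require Import structures.
From mathcomp Require Import all_boot all_order all_algebra.
From mathcomp Require Import complex ring lra zify.
From mathcomp Require Import all_classical all_reals all_analysis.
From mathcomp Require Import measurable_realfun.

Set Implicit Arguments.
Unset Strict Implicit.
Unset Printing Implicit Defensive.
Import Order.TTheory GRing.Theory Num.Theory.
Import numFieldNormedType.Exports.
Local Open Scope classical_set_scope.
Local Open Scope ring_scope.
Local Open Scope complex_scope.

(** * Fourier transform of the Gaussian on the line *)

(** Since [R_l] may be chosen with no regularity in [l] beyond measurability of [L1_error P], the
    integrals over [nu] and over the torus cannot be exchanged by Fubini: [D_l x] need not be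
    jointly measurable. Testing against a trigonometric polynomial [T] avoids the exchange. The
    integral of [D_l T] is a finite combination of coefficients of [D_l], so a positive linear
    functional on functions of [l] acts on it term by term. The sign of [D_l] also bounds its
    coefficients: each one is at most the mean of [D_l] in absolute value, and that mean is exactly
    [L1_error]. The mean is thus integrable from the outset, the extended functional agrees with the
    integral on it, and the total error comes out as an equality. Concentration at a point uses
    powers of a single trigonometric polynomial that peaks there, so closure under products and
    compactness suffice, without estimates for a summability kernel. The coefficients of [f_l] come
    from unfolding in one variable and factorization over the coordinates. Coefficients are handled
    in real cosine and sine form, with [k] and [- k] both listed. *)

Section gaussian_fourier.
Context {R : realType}.
Implicit Types (l t x c : R).
Local Notation mu := (@lebesgue_measure R).

Definition gauss1 l x : R := expR (- (l * pi * x ^+ 2)).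

Lemma gauss1_ge0 l x : 0 <= gauss1 l x.
Proof. exact: expR_ge0. Qed.

Lemma is_derive_gauss1 l x :
  is_derive x 1 (gauss1 l) (- (2 * pi * l * x) * gauss1 l x).
Proof.
rewrite mulrC; apply: is_derive1_comp; apply: is_derive_eq.
by rewrite /GRing.scale/=; ring.
Qed.

Lemma continuous_gauss1 l : continuous (gauss1 l).
Proof.
move=> x; apply: differentiable_continuous; apply/derivable1_diffP.
exact: (@ex_derive _ _ _ _ _ _ _ (is_derive_gauss1 l x)).
Qed.

Lemma is_derive_cosM t c x :
  is_derive x 1 (fun x => cos (2 * pi * (t * x) +
      c)) (- (2 * pi * t) * sin (2 * pi * (t * x) + c)).
Proof.
rewrite [X in is_derive _ _ _ X](_ : _ = - sin (2 * pi * (t * x) + c) * (2 * pi * t));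
    last by ring.
apply: (is_derive1_comp (g := fun x => 2 * pi * (t * x) + c)); apply: is_derive_eq.
by rewrite /GRing.scale/=; ring.
Qed.

Lemma is_derive_sinM t c x :
  is_derive x 1 (fun x => sin (2 * pi * (t * x) +
      c)) ((2 * pi * t) * cos (2 * pi * (t * x) + c)).
Proof.
rewrite [X in is_derive _ _ _ X]mulrC.
apply: (is_derive1_comp (g := fun x => 2 * pi * (t * x) + c)); apply: is_derive_eq.
by rewrite /GRing.scale/=; ring.
Qed.

(** The standard deviation for which the exponent of the normal density is [- l * pi * x ^+ 2];
    integrability and total mass of [gauss1 l] are then read off the normal law. *)
Lemma normal_fun_gauss1 l : 0 < l ->
  normal_fun 0 (Num.sqrt (2 * pi * l)^-1) = gauss1 l.
Proof.
move=> l0; apply/funext => x; rewrite /normal_fun /gauss1.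
have p0 : 0 < pi :> R by exact: pi_gt0.
rewrite sqr_sqrtr ?invr_ge0 ?mulr_ge0 ?ltW// subr0; congr expR.
by move: pi p0 => p p0; rewrite -mulr_natr; field; rewrite !gt_eqF.
Qed.

Let sigma_neq0 l : 0 < l -> Num.sqrt (2 * pi * l)^-1 != 0 :> R.
Proof.
by move=> l0; rewrite gt_eqF// sqrtr_gt0 invr_gt0 !mulr_gt0 ?pi_gt0.
Qed.

Let peakE l : 0 < l -> normal_peak (Num.sqrt (2 * pi * l)^-1) = Num.sqrt l.
Proof.
move=> l0; rewrite /normal_peak.
have p0 : 0 < pi :> R by exact: pi_gt0.
rewrite sqr_sqrtr ?invr_ge0 ?mulr_ge0 ?ltW//.
rewrite -[RHS]invrK -(@sqrtrV _ l) ?ltW//.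
congr (_^-1); congr Num.sqrt.
move: pi p0 => p p0.
rewrite -mulr_natr.
by field; rewrite !gt_eqF.
Qed.

Lemma integrable_gauss1 l : 0 < l -> mu.-integrable setT (EFin \o gauss1 l).
Proof.
move=> l0.
have := integrable_normal_pdf 0 (Num.sqrt (2 * pi * l)^-1).
rewrite normal_pdfE ?sigma_neq0// normal_fun_gauss1// peakE//.
move=> /(integrableZl measurableT (Num.sqrt l)^-1); apply: eq_integrable => //.
move=> x _ /=; rewrite -EFinM mulKf// gt_eqF// sqrtr_gt0//.
Qed.

Lemma Rintegral_gauss1 l : 0 < l -> (\int[mu]_x gauss1 l x)%R = (Num.sqrt l)^-1.
Proof.
move=> l0.
have := integral_normal_pdf 0 (Num.sqrt (2 * pi * l)^-1).
rewrite normal_pdfE ?sigma_neq0// normal_fun_gauss1// peakE//.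
under eq_integral do rewrite EFinM.
rewrite integralZl//; last exact: integrable_gauss1.
rewrite /Rintegral => h.
have : fine ((Num.sqrt l)%:E * \int[mu]_x (gauss1 l x)%:E)%E = 1 by rewrite h.
rewrite fineM//; last by apply: integrable_fin_num => //; exact: integrable_gauss1.
move=> /= h1; apply: (mulfI (x := Num.sqrt l)); first by rewrite gt_eqF// sqrtr_gt0.
by rewrite h1 divff// gt_eqF// sqrtr_gt0.
Qed.

(** The fundamental theorem of calculus on [[- n, n]], then dominated convergence with [|f|] as
    majorant. Limits of [F] along the integers are enough. *)
Lemma Rintegral_exact (f F : R -> R) :
  (forall x, is_derive x 1 F (f x)) -> continuous f ->
  mu.-integrable setT (EFin \o f) ->
  (fun n => F n%:R) @ \oo --> 0 -> (fun n => F (- n%:R)) @ \oo --> 0 ->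
  (\int[mu]_x f x)%R = 0.
Proof.
move=> dF cf intf Fy FNy.
have : (fun n => \int[mu]_x ((EFin \o f) \_ `[(- n%:R)%R,
    (n%:R)%R]) x)%E @ \oo --> (\int[mu]_x (f x)%:E)%E.
  have mf := measurable_int _ intf.
  apply: (@dominated_cvg _ _ _ mu _ _ _ _ (abse \o (EFin \o f))) => //.
  - by move=> n; apply/measurable_restrict => //; apply: measurable_funS mf.
  - move=> x _; apply: cvg_near_cst; near=> n.
    rewrite patchE mem_set//= in_itv/= -ler_norml.
    by near: n; apply: nbhs_infty_ger.
  - exact: integrable_abse.
  - move=> n x _; rewrite patchE; case: ifPn => //= _; by rewrite normr0 lee_fin.
rewrite [X in X @ _ --> _ -> _](_ : _ = (fun n => (F n%:R - F (- n%:R))%:E)); last first.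
  apply/funext => n; rewrite -integral_mkcond.
  (* The fundamental theorem asks for a nondegenerate interval, so [n = 0] is treated apart. *)
  have [->|n0] := eqVneq n 0%N; first by rewrite oppr0 subrr set_itv1 integral_set1.
  apply: continuous_FTC2.
  - have : 0 < n%:R :> R by rewrite ltr0n lt0n.
    by move=> n1; rewrite (lt_trans _ n1)// oppr_lt0.
  - exact: continuous_subspaceT.
  - have cF x : {for x, continuous F}.
      apply: differentiable_continuous; apply/derivable1_diffP.
      exact: (@ex_derive _ _ _ _ _ _ _ (dF x)).
    split.
    + by move=> x _; exact: (@ex_derive _ _ _ _ _ _ _ (dF x)).
    + by apply: cvg_at_right_filter; exact: cF.
    + by apply: cvg_at_left_filter; exact: cF.
  - by move=> x _; rewrite derive1E; apply: derive_val.
move=> h; apply: EFin_inj; rewrite /Rintegral fineK; last exact: integrable_fin_num.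
have h2 : (fun n => (F n%:R - F (- n%:R))%:E) @ \oo --> (0 - 0 : R)%:E.
  by apply: cvg_EFin; [exact: nearW|exact: cvgB].
rewrite subr0 in h2.
exact: cvg_unique h h2.
Unshelve. all: by end_near. Qed.

(** An integrable majorant of [|x| * gauss1 l x]. One bounds [|x|] by [1 + x ^+ 2] and lets half of
    the exponent absorb the square; [2 / (l * pi)] comes from [1 + u <= expR u] at
    [u = l / 2 * pi * x ^+ 2]. *)
Let G l x := (1 + 2 / (l * pi)) * gauss1 (l / 2) x.

Let gauss1_split l x : gauss1 l x = gauss1 (l / 2) x * gauss1 (l / 2) x.
Proof. by rewrite /gauss1 -expRD; congr expR; field. Qed.

Let sqr_gauss1 l x : 0 < l -> x ^+ 2 * gauss1 (l / 2) x <= 2 / (l * pi).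
Proof.
move=> l0; rewrite /gauss1 expRN ler_pdivrMr ?expR_gt0//.
have lp0 : 0 < l * pi by rewrite mulr_gt0 ?pi_gt0.
rewrite mulrAC ler_pdivlMr//.
apply: (@le_trans _ _ (2 * (1 + l / 2 * pi * x ^+ 2))).
  by move: (pi) lp0 => p lp0; lra.
by rewrite ler_pM2l// expR_ge1Dx.
Qed.

Let abs_gauss1 l x : 0 < l -> `|x| * gauss1 l x <= G l x.
Proof.
move=> l0; rewrite gauss1_split mulrA ler_wpM2r ?gauss1_ge0//.
apply: (@le_trans _ _ ((1 + x ^+ 2) * gauss1 (l / 2) x)).
  rewrite ler_wpM2r ?gauss1_ge0//.
  have := sqr_ge0 (`|x| - 1); rewrite sqrrB real_normK ?num_real// expr1n mulr1.
  have := normr_ge0 x; have := sqr_ge0 x; lra.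
rewrite mulrDl mul1r lerD ?sqr_gauss1//.
by rewrite -expR0 ler_expR oppr_le0 mulr_ge0 ?sqr_ge0// mulr_ge0 ?pi_ge0// divr_ge0// ltW.
Qed.

Let G_ge0 l x : 0 < l -> 0 <= G l x.
Proof.
by move=> l0; rewrite mulr_ge0 ?gauss1_ge0// addr_ge0// divr_ge0// ltW// mulr_gt0 ?pi_gt0.
Qed.

Let integrable_G l : 0 < l -> mu.-integrable setT (EFin \o G l).
Proof.
move=> l0; have := integrable_gauss1 (divr_gt0 l0 (ltr0Sn R 1)).
by move=> /(integrableZl measurableT (1 + 2 / (l * pi))); apply: eq_integrable.
Qed.

Lemma continuous_cosM t c : continuous (fun x => cos (2 * pi * (t * x) + c)).
Proof.
move=> x; apply: differentiable_continuous; apply/derivable1_diffP.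
exact: (@ex_derive _ _ _ _ _ _ _ (is_derive_cosM t c x)).
Qed.

Lemma continuous_sinM t c : continuous (fun x => sin (2 * pi * (t * x) + c)).
Proof.
move=> x; apply: differentiable_continuous; apply/derivable1_diffP.
exact: (@ex_derive _ _ _ _ _ _ _ (is_derive_sinM t c x)).
Qed.

Lemma integrable_gauss1M l (h : R -> R) (C : R) : 0 < l -> continuous h ->
  (forall x, `|h x| <= C) ->
  mu.-integrable setT (EFin \o (gauss1 l \* h)).
Proof.
move=> l0 ch hC.
apply: (le_integrable measurableT _ _ (integrableZl measurableT C (integrable_gauss1 l0)))
    => //.
  apply/measurable_EFinP/measurable_funM; apply: continuous_measurable_fun => //.
  exact: continuous_gauss1.
move=> x _; rewrite /= lee_fin normrM mulrC normrM ler_wpM2r//.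
by rewrite (le_trans (hC x))// ler_norm.
Qed.

Variable c : R.

Let I l t := (\int[mu]_x (gauss1 l x * cos (2 * pi * (t * x) + c)))%R.

Let J l t := (\int[mu]_x (gauss1 l x * (x * sin (2 * pi * (t * x) + c))))%R.

Let integrable_J l t : 0 < l -> mu.-integrable setT
  (fun x => (gauss1 l x * (x * sin (2 * pi * (t * x) + c)))%:E).
Proof.
move=> l0; apply: (le_integrable measurableT _ _ (integrable_G l0)) => //.
  apply/measurable_EFinP; apply: continuous_measurable_fun => x.
  apply: cvgM; first exact: continuous_gauss1.
  by apply: cvgM; [exact: cvg_id|exact: continuous_sinM].
move=> x _; rewrite /= lee_fin (ger0_norm (G_ge0 x l0)) (le_trans _ (abs_gauss1 x l0))//.
rewrite !normrM ger0_norm ?gauss1_ge0// mulrC ler_wpM2r ?gauss1_ge0//.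
by rewrite ler_piMr// ler_norml sin_geN1 sin_le1.
Qed.

Let integrable_I l t : 0 < l -> mu.-integrable setT
  (fun x => (gauss1 l x * cos (2 * pi * (t * x) + c))%:E).
Proof.
move=> l0; apply: (@integrable_gauss1M _ (fun x => cos (2 * pi * (t * x) + c)) 1) => //.
  exact: continuous_cosM.
by move=> x; rewrite ler_norml cos_geN1 cos_le1.
Qed.

(** Differentiation under the integral sign. Since sine is at most 1 in absolute value,
    [2 * pi * G l x] bounds the [t]-derivative for every [t], so the neighbourhood of radius 1 is an
    arbitrary choice. *)
Let is_derive_I l t : 0 < l -> is_derive t 1 (I l) (- (2 * pi) * J l t).
Proof.
move=> l0.
pose f (t x : R) : R := gauss1 l x * cos (2 * pi * (t * x) + c).
have df (s x : R) : is_derive s 1 (f ^~ x : R -> R) (- (2 * pi) * (gauss1 l x * (x * sin (2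
    * pi * (s * x) + c)))).
  have := is_derive_cosM x c s => h.
  rewrite /f (_ : (fun s => _) = (gauss1 l x) *: (fun s => cos (2 * pi * (x * s) + c)));
      last first.
    by apply/funext => u; rewrite /GRing.scale/= (mulrC u).
  apply: is_derive_eq.
  by rewrite /GRing.scale/= (mulrC x); ring.
have dfE (s x : R) : partial1of2 f s x = - (2 * pi) * (gauss1 l x * (x * sin (2 * pi * (s *
    x) + c))).
  by rewrite partial1of2E; apply: derive_val.
have p0 : 0 <= pi :> R by exact: pi_ge0.
have tI : `](t - 1), (t + 1)[%classic t by rewrite /= in_itv/=; apply/andP; split; lra.
have intf (s : R) : `](t - 1), (t + 1)[%classic s -> mu.-integrable setT (EFin \o f s).
  by move=> _; exact: integrable_I.
have der (s x : R) : `](t - 1), (t + 1)[%classic s -> [set: R] x -> derivable (f ^~ x) s 1.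
  by move=> _ _; exact: (@ex_derive _ _ _ _ _ _ _ (df s x)).
have Gub (s x : R) : `](t - 1), (t + 1)[%classic s -> [set: R] x ->
    `|partial1of2 f s x| <= 2 * pi * G l x.
  move=> _ _; rewrite dfE normrM normrN (@ger0_norm _ (2 * pi)) ?mulr_ge0//
      ler_wpM2l ?mulr_ge0//.
  rewrite (le_trans _ (abs_gauss1 x l0))//.
  rewrite !normrM ger0_norm ?gauss1_ge0// mulrC ler_wpM2r ?gauss1_ge0//.
  by rewrite ler_piMr// ler_norml sin_geN1 sin_le1.
have G0 x : 0 <= 2 * pi * G l x by apply: mulr_ge0; [rewrite mulr_ge0|exact: G_ge0].
have iG : mu.-integrable setT (EFin \o (fun x => 2 * pi * G l x)).
  by have := integrableZl measurableT (2 * pi) (integrable_G l0); exact: eq_integrable.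
have -> : - (2 * pi) * J l t = \int[mu]_x partial1of2 f t x.
  under eq_Rintegral do rewrite dfE.
  by rewrite RintegralZl//; exact: integrable_J.
have D := derivable_under_integral measurableT tI intf der G0 iG Gub.
have := differentiation_under_integral measurableT tI intf der G0 iG Gub.
rewrite derive1E => <-; exact/derivableP.
Qed.

(** Comparison with a multiple of the harmonic sequence: at [m = n.+1],
    [m * gauss1 l m <= m ^+ 2 * gauss1 l m], which [sqr_gauss1] at [l * 2] bounds by [1 / (l * pi)].
    The factor [u] stands for the sine in the boundary terms. *)
Let gauss1_tail l (u : nat -> R) : 0 < l -> (forall n, `|u n| <= 1) ->
  (fun n => l^-1 * (gauss1 l n%:R * u n)) @ \oo --> 0.
Proof.
move=> l0 u1; rewrite -(cvg_shiftS (fun n => l^-1 * (gauss1 l n%:R * u n))) /=.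
apply: norm_cvg0.
have h : (fun n => (l^-1 * (1 / (l * pi))) * harmonic n) @ \oo --> (l^-1 * (1 / (l * pi)))
    * (0 : R).
  by apply: cvgM; [exact: cvg_cst|exact: cvg_harmonic].
rewrite mulr0 in h.
apply: (squeeze_cvgr _ (cvg_cst 0) h); apply: nearW => n; rewrite normr_ge0/=.
rewrite normrM ger0_norm ?invr_ge0 ?(ltW l0)// -mulrA ler_pM2l ?invr_gt0//.
rewrite normrM ger0_norm ?gauss1_ge0//.
apply: (@le_trans _ _ (gauss1 l n.+1%:R)); first by rewrite ler_piMr ?gauss1_ge0.
have := @sqr_gauss1 (l * 2) n.+1%:R; rewrite mulfK// => /(_ (mulr_gt0 l0 (ltr0Sn _ 1))).
rewrite [X in _ <= X -> _](_ : _ = 1 / (l * pi)); last first.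
  by have := @pi_gt0 R; move: (pi) => p p0; field; rewrite !gt_eqF.
move=> h1; rewrite ler_pdivlMr ?ltr0Sn//; apply: le_trans h1.
by rewrite mulrC ler_wpM2r ?gauss1_ge0// expr2 ler_peMr// ler1n.
Qed.

(* The difference of the two integrands is the [x]-derivative of
   [l^-1 * gauss1 l x * sin (2 * pi * (t * x) + c)], which vanishes at infinity. *)
Let I_J l t : 0 < l -> 2 * pi * J l t = 2 * pi * t / l * I l t.
Proof.
move=> l0.
pose F x := l^-1 * (gauss1 l x * sin (2 * pi * (t * x) + c)).
pose f x := 2 * pi * t / l * (gauss1 l x * cos (2 * pi * (t * x) + c)) -
   2 * pi * (gauss1 l x * (x * sin (2 * pi * (t * x) + c))).
have dF x : is_derive x 1 F (f x).
  have h1 := is_derive_gauss1 l x.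
  have h2 := is_derive_sinM t c x.
  rewrite /F (_ : (fun s => _) = l^-1 *: (gauss1 l * (fun x =>
      sin (2 * pi * (t * x) + c)))); last first.
    by apply/funext => u.
  apply: is_derive_eq.
  rewrite /f /GRing.scale/=.
  move: (gauss1 l x) (sin (2 * pi * (t * x) + c)) (cos (2 * pi * (t * x) + c)) (pi) =>
      u v w p.
  by field; rewrite gt_eqF.
have iI := integrableZl measurableT (2 * pi * t / l) (integrable_I t l0).
have iJ := integrableZl measurableT (2 * pi) (integrable_J t l0).
have : \int[mu]_x f x = 0.
  apply: (Rintegral_exact dF).
  - move=> x; apply: cvgB; apply: cvgM; try exact: cvg_cst.
      by apply: cvgM; [exact: continuous_gauss1|exact: continuous_cosM].
    apply: cvgM; [exact: continuous_gauss1|].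
    by apply: cvgM; [exact: cvg_id|exact: continuous_sinM].
  - have := integrableB measurableT iI iJ.
    exact: eq_integrable.
  - have -> : (fun n => F n%:R) = (fun n => l^-1 * (gauss1 l n%:R * sin (2 * pi * (t *
      n%:R) + c))).
      by [].
    by apply: gauss1_tail => // n; rewrite ler_norml sin_geN1 sin_le1.
  - have -> : (fun n => F (- n%:R)) = (fun n => l^-1 * (gauss1 l n%:R * sin (2 * pi * (t *
      (- n%:R)) + c))).
      by apply/funext => n; rewrite /F /gauss1 sqrrN.
    by apply: gauss1_tail => // n; rewrite ler_norml sin_geN1 sin_le1.
rewrite /f RintegralB//; try by [apply: iI|apply: iJ].
rewrite !RintegralZl//; try by [exact: integrable_I|exact: integrable_J].
by move/eqP; rewrite subr_eq0 => /eqP.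
Qed.

(** By [is_derive_I] and [I_J], [I l] solves [I' = - (2 * pi * t / l) * I], so its product with
    [expR (pi * t ^+ 2 / l)] is constant and is evaluated at [t = 0]. The phase [c] covers both
    transforms: [c = 0] gives the cosine, [c = - (pi / 2)] the sine, for which the factor [cos c]
    vanishes. *)
Lemma Rintegral_gauss1_cos_phase l t : 0 < l ->
  \int[mu]_x (gauss1 l x * cos (2 * pi * (t * x) + c)) =
  cos c * (Num.sqrt l)^-1 * expR (- (pi * t ^+ 2 / l)).
Proof.
move=> l0.
pose K t := I l t * expR (pi * t ^+ 2 / l).
have dK (s : R) : is_derive s 1 K 0.
  have h1 := is_derive_I s l0.
  have h2 : is_derive s 1 (fun t => expR (pi * t ^+ 2 / l)) (expR (pi * s ^+ 2 / l) * (2 *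
      pi * s / l)).
    apply: is_derive1_comp; apply: is_derive_eq.
    by rewrite /GRing.scale/= ?expr1; move: (pi) => p; ring.
  rewrite /K (_ : (fun s => _) = I l * (fun t => expR (pi * t ^+ 2 / l)));
      last by apply/funext => u.
  apply: is_derive_eq.
  rewrite /GRing.scale/= mulNr I_J//.
  by move: (I l s) (expR (pi * s ^+ 2 / l)) (pi) => u v p; ring.
have := is_derive_0_is_cst t 0 dK.
rewrite /K expr0n/= mulr0 mul0r expR0 mulr1.
rewrite expRN => h; rewrite -/(I l t).
rewrite -(_ : I l 0 = cos c * (Num.sqrt l)^-1).
  by rewrite -h mulfK// gt_eqF// expR_gt0.
rewrite /I; under eq_Rintegral do rewrite mul0r mulr0 add0r mulrC.
by rewrite RintegralZl// ?Rintegral_gauss1//; exact: integrable_gauss1.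
Qed.

End gaussian_fourier.

Lemma Rintegral_gauss1_cos {R : realType} (l t : R) : 0 < l ->
  \int[@lebesgue_measure R]_x (gauss1 l x * cos (2 * pi * (t * x))) =
  (Num.sqrt l)^-1 * expR (- (pi * t ^+ 2 / l)).
Proof.
move=> /(Rintegral_gauss1_cos_phase 0 t); rewrite cos0 mul1r => <-.
by apply: eq_Rintegral => x _; rewrite addr0.
Qed.

Lemma Rintegral_gauss1_sin {R : realType} (l t : R) : 0 < l ->
  \int[@lebesgue_measure R]_x (gauss1 l x * sin (2 * pi * (t * x))) = 0.
Proof.
move=> /(Rintegral_gauss1_cos_phase (- (pi / 2)) t).
rewrite cosN cos_pihalf !mul0r => <-.
by apply: eq_Rintegral => x _; rewrite cosD cosN sinN cos_pihalf sin_pihalf; congr *%R;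
    ring.
Qed.

(** * Periodization on the line *)

Section periodization.
Context {R : realType}.
Implicit Types (l t x : R) (u : R -> R).
Local Notation mu := (@lebesgue_measure R).

(** Pairing [n] with [- (n + 1)] turns a sum over the integers into a series over [nat], to which
    monotone convergence and measurability of series apply. *)
Lemma esum_int (a : int -> \bar R) : (forall n, 0 <= a n)%E ->
  (\esum_(n in [set: int]) a n = \sum_(0 <= n <oo) (a (Posz n) + a (Negz n)))%E.
Proof.
move=> a0.
rewrite (esumID (range Posz))// !setTI.
rewrite (_ : ~` range Posz = range Negz); last first.
  apply/seteqP; split=> [[n|n]|_ [n _ <-]] /=; last by move=> [].
    by move=> []; exists n.
  by exists n.
rewrite !esum_image; [|by move=> ? ? _ _ []..].
rewrite -!nneseries_esumT// nneseriesD//.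
Qed.

Lemma Rfloor_bigcup : \bigcup_n ([set` `[(Posz n)%:~R : R, (Posz n + 1)%:~R[] `|`
    [set` `[(Negz n)%:~R : R, (Negz n + 1)%:~R[]) = setT.
Proof.
apply/seteqP; split => // x _.
have := floor_itv x; case: (Num.floor x) => n h; exists n => //; [left|right];
  by rewrite /= in_itv.
Qed.

Lemma Rfloor_trivIset : trivIset [set: nat]
  (fun n => [set` `[(Posz n)%:~R : R, (Posz n + 1)%:~R[] `|`
    [set` `[(Negz n)%:~R : R, (Negz n + 1)%:~R[]).
Proof.
move=> i j _ _ [x [/= hi hj]].
have : Num.floor x = Posz i \/ Num.floor x = Negz i.
  by case: hi => hi; [left|right]; apply: floor_def; rewrite in_itv/= in hi.
have : Num.floor x = Posz j \/ Num.floor x = Negz j.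
  by case: hj => hj; [left|right]; apply: floor_def; rewrite in_itv/= in hj.
by move=> [] -> [] [].
Qed.

Lemma integral_shift u (z : int) : continuous u ->
  (\int[mu]_(x in [set` `[z%:~R, (z + 1)%:~R[]) (u x)%:E =
   \int[mu]_(x in `[0%R, 1%R[) (u (x + z%:~R))%:E)%E.
Proof.
move=> cu.
have cuz : continuous (fun x => u (x + z%:~R)).
  move=> x; apply: (@continuous_comp _ _ _ (fun x => x + z%:~R) u); last exact: cu.
  by apply: cvgD; [exact: cvg_id|exact: cvg_cst].
(* Passing to closed intervals costs nothing, the end point being null, and is the form required by
   the substitution below. *)
rewrite !integral_itv_bndo_bndc; last 2 first.
- by apply/measurable_EFinP; apply: measurable_funTS; exact: continuous_measurable_fun.
- by apply/measurable_EFinP; apply: measurable_funTS; exact: continuous_measurable_fun.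
pose F x := x + z%:~R.
have dF x : is_derive x 1 F 1 by apply: is_derive_eq; rewrite addr0.
have F'E : F^`()%classic = cst 1.
  by apply/funext => x; rewrite derive1E; apply: derive_val.
have cF x : {for x, continuous F} by apply: cvgD; [exact: cvg_id|exact: cvg_cst].
rewrite {1}(_ : z%:~R = F 0); last by rewrite /F add0r.
rewrite (_ : (z + 1)%:~R = F 1); last by rewrite /F intrD addrC.
rewrite (integration_by_substitution_increasing (F := F)) ?F'E//.
- by apply: eq_integral => x _ /=; rewrite mulr1.
- by move=> x y _ _ xy; rewrite ltrD2r.
- by move=> x _; exact: cvg_cst.
- exact: is_cvg_cst.
- exact: is_cvg_cst.
- split; [by move=> x _; exact: (@ex_derive _ _ _ _ _ _ _ (dF x))| |].
    by apply: cvg_at_right_filter; exact: cF.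
  by apply: cvg_at_left_filter; exact: cF.
- exact: continuous_subspaceT.
Qed.

(** The line is cut into unit intervals, each is translated to [[0, 1[], and sum and integral are
    exchanged by nonnegativity; both sides may be infinite. *)
Lemma integral_unfold u : continuous u -> (forall x, 0 <= u x) ->
  (\int[mu]_x (u x)%:E = \int[mu]_(x in `[0%R, 1%R[)
    \esum_(n in [set: int]) (u (x + n%:~R))%:E)%E.
Proof.
move=> cu u0.
have mu' (z : int) D : measurable D -> measurable_fun D (fun x => (u (x + z%:~R))%:E).
  move=> mD; apply/measurable_EFinP; apply: measurable_funTS;
      apply: continuous_measurable_fun.
  move=> x; apply: (@continuous_comp _ _ _ (fun x => x + z%:~R) u); last exact: cu.
  by apply: cvgD; [exact: cvg_id|exact: cvg_cst].
rewrite -Rfloor_bigcup ge0_integral_bigcup//=; first last.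
- exact: Rfloor_trivIset.
- by move=> x _; rewrite lee_fin.
- by rewrite Rfloor_bigcup; apply/measurable_EFinP; exact: continuous_measurable_fun.
- by move=> k; exact: measurableU.
transitivity (\sum_(0 <= n <oo) (\int[mu]_(x in `[0%R, 1%R[)
   ((u (x + (Posz n)%:~R))%:E + (u (x + (Negz n)%:~R))%:E)))%E.
  apply: eq_eseriesr => n _.
  rewrite ge0_integral_setU//=; first last.
  - apply/disj_setPS => x [/=]; rewrite !in_itv/= => h1 h2.
    by have := floor_def h1; rewrite (floor_def h2).
  - by move=> x _; rewrite lee_fin.
  - by apply/measurable_EFinP; apply: measurable_funTS; exact: continuous_measurable_fun.
  rewrite !integral_shift// ge0_integralD//=; try by move=> *; rewrite lee_fin.
  - exact: mu'.
  - exact: mu'.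
rewrite -integral_nneseries//; first last.
- by move=> *; rewrite adde_ge0// lee_fin.
- by move=> n; apply: emeasurable_funD; exact: mu'.
by apply: eq_integral => x _; rewrite esum_int// => n; rewrite lee_fin.
Qed.

(** The one-dimensional periodized Gaussian, a Jacobi theta function. [fine] loses nothing on [[0,
    1[], by [esum_gauss1_fin]. *)
Definition theta l x : R := fine (\esum_(n in [set: int]) (gauss1 l (x + n%:~R))%:E)%E.

(** For [x] in [[0, 1[] both [x + n] and [x - (n + 1)] have absolute value at least [n], hence
    square at least [n]. Each pair of terms is therefore at most [2 * q ^+ n] with
    [q = expR (- (l * pi)) < 1]. *)
Lemma esum_gauss1_fin l x : 0 < l -> 0 <= x < 1 ->
  (\esum_(n in [set: int]) (gauss1 l (x + n%:~R))%:E)%E \is a fin_num.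
Proof.
move=> l0 /andP[x0 x1].
have lp : 0 < l * pi by rewrite mulr_gt0 ?pi_gt0.
rewrite ge0_fin_numE; last by apply: esum_ge0 => n _; rewrite lee_fin gauss1_ge0.
rewrite esum_int; last by move=> n; rewrite lee_fin gauss1_ge0.
pose q := expR (- (l * pi)).
have q1 : `|q| < 1 by rewrite ger0_norm ?expR_ge0// -expR0 ltr_expR oppr_lt0.
have gq y n : (n%:R <= `|y|) -> gauss1 l y <= geometric 1 q n.
  move=> ny; rewrite /geometric/= mul1r /q -expRM_natr /gauss1 ler_expR mulNr lerN2
      ler_pM2l//.
  rewrite -real_normK ?num_real//.
  have [->|n0] := eqVneq n 0%N; first by rewrite sqr_ge0.
  have n1 : 1 <= n%:R :> R by rewrite ler1n lt0n.
  rewrite expr2 (le_trans ny)// ler_peMr//; exact: le_trans n1 ny.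
apply: (@le_lt_trans _ _ (\sum_(0 <= n <oo) (2 * geometric 1 q n)%:E)%E).
  apply: lee_nneseries => n _.
    by rewrite adde_ge0// lee_fin gauss1_ge0.
  rewrite -EFinD lee_fin mulr2n mulrDl !mul1r lerD//; apply: gq.
    by rewrite ger0_norm ?addr_ge0// lerDr.
  rewrite NegzE mulrNz ler0_norm; last first.
    by rewrite subr_le0 (le_trans (ltW x1))// ler1n.
  rewrite -[Posz n.+1]/(Posz n.+1) -pmulrn opprB -natr1; lra.
apply: (@le_lt_trans _ _ (2 * (1 / (1 - q)))%:E); last exact: ltry.
apply: lime_le.
  by apply: is_cvg_nneseries => n _ _; rewrite lee_fin mulr_ge0// geometric_ge0 ?expR_ge0.
apply: nearW => n; rewrite sumEFin lee_fin -mulr_sumr ler_pM2l//.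
by have := @geometric_le_lim _ n 1 q ler01 (expR_gt0 _) q1.
Qed.

Lemma measurable_esum_int (u : R -> R) (D : set R) : measurable D -> continuous u ->
  (forall x, 0 <= u x) ->
  measurable_fun D (fun x => \esum_(n in [set: int]) (u (x + n%:~R))%:E)%E.
Proof.
move=> mD cu u0.
have mu' (z : int) : measurable_fun D (fun x => (u (x + z%:~R))%:E).
  apply/measurable_EFinP; apply: measurable_funTS; apply: continuous_measurable_fun.
  move=> x; apply: (@continuous_comp _ _ _ (fun x => x + z%:~R) u); last exact: cu.
  by apply: cvgD; [exact: cvg_id|exact: cvg_cst].
rewrite (_ : (fun x => _) = fun x => (\sum_(0 <= n <oo)
    ((u (x + (Posz n)%:~R))%:E + (u (x + (Negz n)%:~R))%:E))%E); last first.
  by apply/funext => x; rewrite esum_int// => n; rewrite lee_fin.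
apply: ge0_emeasurable_sum.
  by move=> k x _ _; rewrite adde_ge0// lee_fin.
by move=> k _; apply: emeasurable_funD; exact: mu'.
Qed.

Lemma esumZl (T : choiceType) (a : T -> \bar R) (r : R) : 0 <= r ->
    (forall n, 0 <= a n)%E ->
  (\esum_(n in [set: T]) (r%:E * a n) = r%:E * \esum_(n in [set: T]) a n)%E.
Proof.
move=> r0 a0; rewrite /esum -ereal_supZl//; last first.
  by apply/set0P; exists (\sum_(x \in set0) a x)%E; exists set0 => //; exact: fsets_set0.
congr ereal_sup; apply/seteqP; split=> [_ [A fA <-]|_ [_ [A fA <-] <-]] /=.
  by exists (\sum_(x \in A) a x)%E; [exists A|rewrite ge0_mule_fsumr].
by exists A => //; rewrite ge0_mule_fsumr.
Qed.

(** A periodic [w] can be moved inside the sum, so on [[0, 1[] the integrand is the periodization of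
    [gauss1 l x * w x], and unfolding applies. *)
Lemma integral_thetaM l (w : R -> R) : 0 < l -> continuous w ->
  (forall x (n : int), w (x + n%:~R) = w x) -> (forall x, 0 <= w x) ->
  (\int[mu]_(x in `[0%R, 1%R[) (theta l x * w x)%:E = \int[mu]_x (gauss1 l x * w x)%:E)%E.
Proof.
move=> l0 cw pw w0.
rewrite (@integral_unfold (gauss1 l \* w)); last 2 first.
- by move=> x; apply: cvgM; [exact: continuous_gauss1|exact: cw].
- by move=> x; rewrite mulr_ge0 ?gauss1_ge0.
apply: eq_integral => x; rewrite inE/= in_itv/= => x01.
rewrite EFinM fineK ?esum_gauss1_fin// muleC -esumZl//; last first.
  by move=> n; rewrite lee_fin gauss1_ge0.
by apply: eq_esum => n _; rewrite pw EFinM muleC.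
Qed.

Lemma theta_ge0 l x : 0 <= theta l x.
Proof. by apply/fine_ge0/esum_ge0 => n _; rewrite lee_fin gauss1_ge0. Qed.

Lemma integrable_theta l : 0 < l ->
  mu.-integrable `[0, 1[ (EFin \o theta l).
Proof.
move=> l0; apply/integrableP; split.
  apply/measurable_EFinP.
  apply: (@measurableT_comp _ _ _ _ _ _ fine); first exact: fine_measurable.
  apply: measurable_esum_int => //; first exact: continuous_gauss1.
  exact: gauss1_ge0.
under eq_integral do rewrite /= ger0_norm ?theta_ge0// -[X in X%:E]mulr1.
rewrite (@integral_thetaM _ (cst 1))//; last by move=> x; exact: cvg_cst.
under eq_integral do rewrite mulr1.
by apply: integrable_lty => //; exact: integrable_gauss1.
Qed.

(* Unfolding is stated for nonnegative integrands, so [w] is replaced by [1 + w]. *)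
Lemma Rintegral_thetaM l (w : R -> R) : 0 < l -> continuous w ->
  (forall x (n : int), w (x + n%:~R) = w x) -> (forall x, `|w x| <= 1) ->
  \int[mu]_(x in `[0, 1[) (theta l x * w x) = \int[mu]_x (gauss1 l x * w x).
Proof.
move=> l0 cw pw w1.
have c1 : continuous (cst 1 : R -> R) by move=> x; exact: cvg_cst.
have c1w : continuous (fun x => 1 + w x) by move=> x; apply: cvgD;
    [exact: cvg_cst|exact: cw].
have E1 := @integral_thetaM _ (cst 1) l0 c1 (fun _ _ => erefl) (fun _ => ler01).
have E2 : (\int[mu]_(x in `[0%R, 1%R[) (theta l x * (1 + w x))%:E =
   \int[mu]_x (gauss1 l x * (1 + w x))%:E)%E.
  apply: integral_thetaM => //; first by move=> x n; rewrite pw.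
  by move=> x; have := w1 x; rewrite ler_norml => /andP[]; lra.
have i1 : mu.-integrable `[0, 1[ (EFin \o (fun x => theta l x * 1)).
  by apply: eq_integrable (integrable_theta l0) => // x _; rewrite /= mulr1.
have i2 : mu.-integrable `[0, 1[ (EFin \o (fun x => theta l x * w x)).
  apply: (integrableMl _ (integrable_theta l0)) => //; first by apply: measurable_funTS;
      exact: continuous_measurable_fun.
  by exists 1; split; [exact: num_real|move=> M M1 x _ /=; rewrite (le_trans (w1 x))// ltW].
have j1 : mu.-integrable setT (EFin \o (fun x => gauss1 l x * 1)).
  by apply: eq_integrable (integrable_gauss1 l0) => // x _; rewrite /= mulr1.
have j2 := integrable_gauss1M l0 cw w1.
have : \int[mu]_(x in `[0, 1[) (theta l x * (1 + w x)) =
    \int[mu]_x (gauss1 l x * (1 + w x)).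
  by rewrite /Rintegral E2.
under eq_Rintegral do rewrite mulrDr; rewrite RintegralD//.
under [in RHS]eq_Rintegral do rewrite mulrDr; rewrite RintegralD//.
have -> : \int[mu]_(x in `[0, 1[) (theta l x * 1) = \int[mu]_x (gauss1 l x * 1).
  by rewrite /Rintegral E1.
by move/addrI.
Qed.

Lemma periodicz (U V : zmodType) (f : U -> V) (T : U) : periodic f T ->
  forall (z : int) a, f (a + T *~ z) = f a.
Proof.
move=> pf [n|n] a; first exact: (periodicn pf).
by rewrite -(periodicn pf n.+1 (a + _)) NegzE mulrNz -addrA pmulrn addNr addr0.
Qed.

Lemma cosD2piz (a : R) (z : int) : cos (a + 2 * pi * z%:~R) = cos a.
Proof.
rewrite -[RHS](periodicz (@cosD2pi R) z); congr (cos (_ + _)).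
by rewrite mulrzr mulr_natl.
Qed.

Lemma sinD2piz (a : R) (z : int) : sin (a + 2 * pi * z%:~R) = sin a.
Proof.
rewrite -[RHS](periodicz (@sinD2pi R) z); congr (sin (_ + _)).
by rewrite mulrzr mulr_natl.
Qed.

Lemma Rintegral_theta_cos l (k : int) : 0 < l ->
  \int[mu]_(x in `[0, 1[) (theta l x * cos (2 * pi * (k%:~R * x))) =
  (Num.sqrt l)^-1 * expR (- (pi * k%:~R ^+ 2 / l)).
Proof.
move=> l0; rewrite -Rintegral_gauss1_cos//.
apply: (@Rintegral_thetaM l (fun x => cos (2 * pi * (k%:~R * x)))) => //.
- have -> : (fun x => cos (2 * pi * (k%:~R * x))) = (fun x =>
    cos (2 * pi * (k%:~R * x) + 0)).
    by apply/funext => x; rewrite addr0.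
  exact: continuous_cosM.
- move=> x n; rewrite (_ : 2 * pi * _ = 2 * pi * (k%:~R * x) +
    2 * pi * (k * n)%:~R) ?cosD2piz//.
  by rewrite intrM; move: (pi) => p; ring.
- by move=> x; rewrite ler_norml cos_geN1 cos_le1.
Qed.

Lemma Rintegral_theta_sin l (k : int) : 0 < l ->
  \int[mu]_(x in `[0, 1[) (theta l x * sin (2 * pi * (k%:~R * x))) = 0.
Proof.
move=> l0; rewrite -[RHS](Rintegral_gauss1_sin k%:~R l0).
apply: (@Rintegral_thetaM l (fun x => sin (2 * pi * (k%:~R * x)))) => //.
- have -> : (fun x => sin (2 * pi * (k%:~R * x))) = (fun x =>
    sin (2 * pi * (k%:~R * x) + 0)).
    by apply/funext => x; rewrite addr0.
  exact: continuous_sinM.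
- move=> x n; rewrite (_ : 2 * pi * _ = 2 * pi * (k%:~R * x) +
    2 * pi * (k * n)%:~R) ?sinD2piz//.
  by rewrite intrM; move: (pi) => p; ring.
- by move=> x; rewrite ler_norml sin_geN1 sin_le1.
Qed.

End periodization.

(** * Products of functions of one coordinate *)

Section lebn_product.
Context {R : realType}.
Local Notation mu := (@lebesgue_measure R).
Local Notation mR := (measurableTypeR R).

(** Fubini for a product of functions in separate variables, transported along [tcons], of which
    [lebn] is by definition a pushforward. Integrability is delivered together with the value
    because the induction on dimension consumes both. *)
Lemma lebnS_mul d (u : mR -> R) (v : d.-tuple mR -> R) :
  mu.-integrable setT (EFin \o u) -> (lebn R d).-integrable setT (EFin \o v) ->
  (lebn R d.+1).-integrable setT
     (fun t : d.+1.-tuple mR => (u (thead t) * v [tuple of behead t])%:E) /\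
  \int[lebn R d.+1]_t (u (thead t) * v [tuple of behead t]) =
  (\int[mu]_x u x) * (\int[lebn R d]_t v t).
Proof.
move=> iu iv.
pose f (t : d.+1.-tuple mR) : \bar R := (u (thead t) * v [tuple of behead t])%:E.
pose g (p : mR * d.-tuple mR) : \bar R := (u p.1 * v p.2)%:E.
have fg : f \o @tcons R d = g.
  apply/funext => -[x t]; rewrite /f /g /=; congr (_ * v _)%:E.
  by apply/val_inj.
have Mu : measurable_fun setT u by apply/measurable_EFinP; exact: measurable_int iu.
have Mv : measurable_fun setT v by apply/measurable_EFinP; exact: measurable_int iv.
have Mg : measurable_fun setT g.
  apply/measurable_EFinP/measurable_funM.
    by apply: (measurableT_comp Mu); exact: measurable_fst.
  by apply: (measurableT_comp Mv); exact: measurable_snd.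
have Mf : measurable_fun setT f.
  apply/measurable_EFinP/measurable_funM.
    by apply: (measurableT_comp Mu); exact: (measurable_tnth ord0).
  by apply: (measurableT_comp Mv); exact: measurable_behead.
have ig : (mu \x lebn R d)%E.-integrable setT g.
  apply/integrable12ltyP => //.
  under eq_integral do under eq_integral do rewrite /g/= normrM EFinM.
  have E x : (\int[lebn R d]_y (`|u x|%:E * `|v y|%:E) =
      `|u x|%:E * \int[lebn R d]_y `|v y|%:E)%E.
    by rewrite ge0_integralZl//; apply/measurable_EFinP; exact: measurableT_comp.
  under eq_integral do rewrite E.
  rewrite ge0_integralZr//; last 2 first.
  - apply/measurable_EFinP; exact: measurableT_comp.
  - exact: integral_ge0.
  move/integrableP: iu => [_ iu]; move/integrableP: iv => [_ iv].
  by rewrite lte_mul_pinfty ?integral_ge0// ge0_fin_numE ?integral_ge0.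
have lE : lebn R d.+1 = pushforward (mu \x lebn R d)%E (@tcons R d) by [].
split.
  rewrite lE; apply: integrable_pushforward => //; first exact: measurable_tcons.
  by rewrite -/f fg.
have E1 : (\int[lebn R d.+1]_t f t = \int[mu \x lebn R d]_p g p)%E.
  rewrite lE -fg.
  apply: (@integral_pushforward _ _ _ _ R (@tcons R d) (@measurable_tcons R d)
    (mu \x lebn R d)%E setT f Mf) => //.
  by rewrite fg.
rewrite {1}/Rintegral E1 -integral12_prod_meas1//=.
rewrite /fubini_F /g/=.
under eq_integral do under eq_integral do rewrite EFinM.
under eq_integral => x _ do rewrite integralZl//.
have -> : (\int[lebn R d]_x (v x)%:E = (\int[lebn R d]_t v t)%:E)%E.
  by rewrite fineK//; exact: integrable_fin_num.
under eq_integral => x _ do rewrite muleC.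
rewrite integralZl// fineM//; first by rewrite mulrC.
exact: integrable_fin_num.
Qed.


(** Induction on [d] through the addition formulas, which mix cosine and sine; hence the joint
    statement. Every product containing a one-dimensional sine integral vanishes, so only the
    product of cosine integrals survives. *)
Lemma lebn_prod_trig d (f : 'I_d -> mR -> R) (k : 'I_d -> R) :
  (forall j, mu.-integrable setT (EFin \o f j)) ->
  (forall j, \int[mu]_x (f j x * sin (2 * pi * (k j * x))) = 0) ->
  let p (t : d.-tuple mR) := 2 * pi * \sum_j k j * tnth t j in
  [/\ (lebn R d).-integrable setT (fun t => (\prod_j f j (tnth t j) * cos (p t))%:E),
    (lebn R d).-integrable setT (fun t => (\prod_j f j (tnth t j) * sin (p t))%:E),
    \int[lebn R d]_t (\prod_j f j (tnth t j) * cos (p t)) =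
      \prod_j \int[mu]_x (f j x * cos (2 * pi * (k j * x))) &
    \int[lebn R d]_t (\prod_j f j (tnth t j) * sin (p t)) = 0].
Proof.
elim: d f k => [|d IH] f k fi fs /=.
  have lE : lebn R 0 = dirac [tuple] by [].
  have m0 (h : 0.-tuple mR -> R) : measurable_fun setT (fun t => (h t)%:E).
    rewrite (_ : (fun _ => _) = cst (h [tuple])%:E); first exact: measurable_cst.
    by apply/funext => t; rewrite (tuple0 t).
  have E (h : 0.-tuple mR -> R) : (\int[lebn R 0]_t (h t)%:E = (h [tuple])%:E)%E.
    by rewrite lE integral_dirac// diracE mem_set// mul1e.
  have Ei (h : 0.-tuple mR -> R) : (lebn R 0).-integrable setT (fun t => (h t)%:E).
    by apply/integrableP; split; [exact: m0|rewrite (E (fun t => `|h t|)) ltry].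
  split; [exact: Ei|exact: Ei| |]; rewrite /Rintegral E !big_ord0 mulr0.
    by rewrite cos0 mulr1.
  by rewrite sin0 mulr0.
have [IHci IHsi IHc IHs] := IH (fun j => f (lift ord0 j)) (fun j => k (lift ord0 j))
  (fun j => fi _) (fun j => fs _).
have bt (t : d.+1.-tuple mR) (j : 'I_d) : tnth [tuple of behead t] j = tnth t (lift ord0 j).
  by rewrite !(tnth_nth 0)/= nth_behead.
pose g j := f (lift ord0 j).
pose q (t : d.-tuple mR) : R := 2 * pi * \sum_j k (lift ord0 j) * tnth t j.
have {}IHci : (lebn R d).-integrable setT (fun t =>
    (\prod_j g j (tnth t j) * cos (q t))%:E).
  exact: IHci.
have {}IHsi : (lebn R d).-integrable setT (fun t =>
    (\prod_j g j (tnth t j) * sin (q t))%:E).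
  exact: IHsi.
have {}IHs : \int[lebn R d]_t (\prod_j g j (tnth t j) * sin (q t)) = 0 by exact: IHs.
pose c x : R := cos (2 * pi * (k ord0 * x)).
pose s x : R := sin (2 * pi * (k ord0 * x)).
have fM (h : R -> R) : continuous h -> (forall x, `|h x| <= 1) ->
    mu.-integrable setT (EFin \o (fun x => f ord0 x * h x)).
  move=> ch h1.
  apply: (integrableMl _ (fi ord0)) => //; first exact: continuous_measurable_fun.
  by exists 1; split; [exact: num_real|move=> M M1 x _ /=; rewrite (le_trans (h1 x))// ltW].
have ic : mu.-integrable setT (EFin \o (fun x => f ord0 x * c x)).
  apply: fM; last by move=> x; rewrite ler_norml cos_geN1 cos_le1.
  have -> : c = (fun x => cos (2 * pi * (k ord0 * x) + 0)) by apply/funext => x;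
      rewrite addr0.
  exact: continuous_cosM.
have is' : mu.-integrable setT (EFin \o (fun x => f ord0 x * s x)).
  apply: fM; last by move=> x; rewrite ler_norml sin_geN1 sin_le1.
  have -> : s = (fun x => sin (2 * pi * (k ord0 * x) + 0)) by apply/funext => x;
      rewrite addr0.
  exact: continuous_sinM.
have [cc1 cc2] := lebnS_mul ic IHci.
have [cs1 cs2] := lebnS_mul ic IHsi.
have [sc1 sc2] := lebnS_mul is' IHci.
have [ss1 ss2] := lebnS_mul is' IHsi.
have pE (t : d.+1.-tuple mR) : 2 * pi * (\sum_j k j * tnth t j) =
    2 * pi * (k ord0 * thead t) + q [tuple of behead t].
  rewrite big_ord_recl mulrDr /q; congr (_ + _ * _); apply: eq_bigr => j _; by rewrite bt.
have fE (t : d.+1.-tuple mR) : \prod_j f j (tnth t j) =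
    f ord0 (thead t) * \prod_j g j (tnth [tuple of behead t] j).
  by rewrite big_ord_recl; congr *%R; apply: eq_bigr => j _; rewrite bt.
have cE (t : d.+1.-tuple mR) : \prod_j f j (tnth t j) * cos (2 * pi * (\sum_j k j * tnth t
    j)) =
    f ord0 (thead t) * c (thead t) * (\prod_j g j (tnth [tuple of behead t] j) * cos (q
        [tuple of behead t]))
  - f ord0 (thead t) * s (thead t) * (\prod_j g j (tnth [tuple of behead t] j) * sin (q
      [tuple of behead t])).
  by rewrite pE fE cosD -/(c _) -/(s _); ring.
have sE (t : d.+1.-tuple mR) : \prod_j f j (tnth t j) * sin (2 * pi * (\sum_j k j * tnth t
    j)) =
    f ord0 (thead t) * s (thead t) * (\prod_j g j (tnth [tuple of behead t] j) * cos (q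
        [tuple of behead t]))
  + f ord0 (thead t) * c (thead t) * (\prod_j g j (tnth [tuple of behead t] j) * sin (q
      [tuple of behead t])).
  by rewrite pE fE sinD -/(c _) -/(s _); ring.
split.
- by apply: eq_integrable (integrableB measurableT cc1 ss1) => // t _; rewrite cE.
- by apply: eq_integrable (integrableD measurableT sc1 cs1) => // t _; rewrite sE.
- under eq_Rintegral do rewrite cE.
  rewrite RintegralB// cc2 ss2 fs mul0r subr0 big_ord_recl; congr *%R.
  exact: IHc.
- under eq_Rintegral do rewrite sE.
  by rewrite RintegralD// sc2 cs2 fs IHs mul0r mulr0 addr0.
Qed.

End lebn_product.

(** * Integrals over the fundamental domain *)

Section cube.
Context {R : realType} {d : nat}.
Local Notation mu := (@lebesgue_measure R).
Local Notation mR := (measurableTypeR R).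
Implicit Types (F : 'rV[R]_d -> R) (k : 'rV[int]_d).

Definition tvec (t : d.-tuple mR) : 'rV[R]_d := \row_j tnth t j.

Definition tint F := (lebn R d).-integrable (@unit_cube R d) (fun t => (F (tvec t))%:E).

Definition tor F : R := \int[lebn R d]_(t in @unit_cube R d) F (tvec t).

Definition phase k (x : 'rV[R]_d) : R := 2 * pi * \sum_j (k ord0 j)%:~R * x ord0 j.

Lemma measurable_cube : measurable (@unit_cube R d).
Proof.
have -> : @unit_cube R d = \bigcap_(j in [set: 'I_d]) ((@tnth d mR)^~ j @^-1` `[0, 1[).
  apply/seteqP; split=> t /= h; first by move=> j _; exact: h.
  by move=> j; exact: h.
apply: fin_bigcap_measurable; first exact: finite_finset.
by move=> j _; rewrite -[X in measurable X]setTI; exact: (measurable_tnth j).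
Qed.

(** Each factor is extended by 0 outside [[0, 1[]. The product then vanishes off the cube, where
    some coordinate leaves [[0, 1[], so the integral over the cube is one over the whole space. *)
Lemma tor_prod (f : 'I_d -> R -> R) k :
  (forall j, mu.-integrable `[0, 1[ (EFin \o f j)) ->
  (forall j, \int[mu]_(x in `[0, 1[) (f j x * sin (2 * pi * ((k ord0 j)%:~R * x))) = 0) ->
  [/\ tint (fun x => \prod_j f j (x ord0 j) * cos (phase k x)),
     tint (fun x => \prod_j f j (x ord0 j) * sin (phase k x)),
     tor (fun x => \prod_j f j (x ord0 j) * cos (phase k x)) =
       \prod_j \int[mu]_(x in `[0, 1[) (f j x * cos (2 * pi * ((k ord0 j)%:~R * x))) &
     tor (fun x => \prod_j f j (x ord0 j) * sin (phase k x)) = 0].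
Proof.
move=> fi fs.
pose g j := f j \_ `[0, 1[.
have gM j (h : R -> R) x : g j x * h x = ((fun x => f j x * h x) \_ `[0, 1[) x.
  by rewrite /g !patchE; case: ifP => // _; rewrite mul0r.
have gi j : mu.-integrable setT (EFin \o g j).
  rewrite /g -restrict_EFin.
  by apply/(@integrable_mkcond _ _ _ mu `[0, 1[ (EFin \o f j)).
have gs j : \int[mu]_x (g j x * sin (2 * pi * ((k ord0 j)%:~R * x))) = 0.
  under eq_Rintegral do rewrite (gM j (fun x => sin (2 * pi * ((k ord0 j)%:~R * x)))).
  by rewrite -Rintegral_mkcond.
have [c1 s1 c2 s2] := lebn_prod_trig gi gs.
have pE (t : d.-tuple mR) : phase k (tvec t) = 2 * pi * \sum_j (k ord0 j)%:~R * tnth t j.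
  by rewrite /phase; congr (_ * _); apply: eq_bigr => j _; rewrite mxE.
have cE (h : R -> R) (t : d.-tuple mR) : \prod_j g j (tnth t j) * h (2 * pi * \sum_j (k
    ord0 j)%:~R * tnth t j) =
   ((fun t => \prod_j f j (tvec t ord0 j) * h (phase k (tvec t))) \_ (@unit_cube R d)) t.
  rewrite patchE; case: ifPn => [|/negP nt].
    rewrite inE => ht; rewrite pE; congr *%R; apply: eq_bigr => j _.
    by rewrite /g patchE mem_set ?mxE//; exact: ht.
  have [j hj] : exists j, ~ (tnth t j \in `[0, 1[).
    by apply/existsNP => h1; apply: nt; rewrite inE.
  have gj0 : g j (tnth t j) = 0 by rewrite /g patchE memNset.
  by rewrite (bigD1 j)//= gj0 !mul0r.
rewrite /tint /tor; split.
- apply/(integrable_mkcond _ measurable_cube).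
  apply: eq_integrable c1 => // t _.
  by rewrite (cE cos) !patchE; case: ifP.
- apply/(integrable_mkcond _ measurable_cube).
  apply: eq_integrable s1 => // t _.
  by rewrite (cE sin) !patchE; case: ifP.
- rewrite Rintegral_mkcond.
  under eq_Rintegral do rewrite -(cE cos).
  rewrite c2; apply: eq_bigr => j _; rewrite [RHS]Rintegral_mkcond.
  by apply: eq_Rintegral => x _; rewrite (gM j (fun x =>
      cos (2 * pi * ((k ord0 j)%:~R * x)))).
- rewrite Rintegral_mkcond.
  by under eq_Rintegral do rewrite -(cE sin).
Qed.

End cube.

(** * Fourier coefficients of the periodized Gaussian in several variables *)

Section gauss_periodization_product.
Context {R : realType}.

(** Induction splitting off the first coordinate: nonnegative terms allow the sum to be iterated,
    and finiteness of the factors brings the product back from the extended reals to [R]. *)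
Lemma esum_rV_prod d (u : 'I_d -> int -> R) : (forall j n, 0 <= u j n) ->
  (forall j, (\esum_(n in [set: int]) (u j n)%:E)%E \is a fin_num) ->
  (\esum_(n in [set: 'rV[int]_d]) (\prod_j u j (n ord0 j))%:E =
   (\prod_j fine (\esum_(n in [set: int]) (u j n)%:E))%:E)%E.
Proof.
elim: d u => [|d IH] u u0 uf.
  rewrite (_ : [set: 'rV[int]_0] = [set 0]); last first.
    by apply/seteqP; split=> // n _ /=; apply/rowP => -[].
  by rewrite esum_set1 !big_ord0.
pose e (p : int * 'rV[int]_d) : 'rV[int]_d.+1 := row_mx (\row_(_ < 1) p.1) p.2.
have e0 p : e p ord0 ord0 = p.1.
  have := row_mxEl (\row_(_ < 1) p.1) p.2 ord0 (ord0 : 'I_1); rewrite mxE => <-.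
  by congr (row_mx _ _ _ _); apply/val_inj.
have eS p j : e p ord0 (lift ord0 j) = p.2 ord0 j.
  rewrite -(row_mxEr (\row_(_ < 1) p.1) p.2 ord0 j).
  by congr (row_mx _ _ _ _); apply/val_inj.
have be : set_bij [set: int * 'rV[int]_d] [set: 'rV[int]_d.+1] e.
  split => //.
  - move=> p q _ _ pq; rewrite [p]surjective_pairing [q]surjective_pairing.
    rewrite -!e0 pq; congr pair; apply/rowP => j.
    by rewrite -!eS pq.
  - move=> v _; exists (v ord0 ord0, \row_j v ord0 (lift ord0 j)) => //.
    apply/rowP => j; case: (unliftP ord0 j) => [i|] ->; first by rewrite eS mxE.
    by rewrite e0.
rewrite (reindex_esum _ _ _ _ be).
pose T := (\prod_j fine (\esum_(n in [set: int]) (u (lift ord0 j) n)%:E)%E).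
have T0 : 0 <= T.
  by apply: prodr_ge0 => j _; apply/fine_ge0/esum_ge0 => n _; rewrite lee_fin.
transitivity (\esum_(n in [set: int]) \esum_(v in [set: 'rV[int]_d])
   ((u ord0 n)%:E * (\prod_j u (lift ord0 j) (v ord0 j))%:E))%E.
  rewrite esum_esum; last first.
    by move=> *; rewrite mule_ge0// lee_fin// prodr_ge0.
  rewrite (_ : [set: _] `*`` _ = setT); last by apply/seteqP; split.
  apply: eq_esum => p _; rewrite big_ord_recl e0 EFinM.
  by congr (_ * (_)%:E)%E; apply: eq_bigr => j _; rewrite eS.
transitivity (\esum_(n in [set: int]) (T%:E * (u ord0 n)%:E))%E.
  apply: eq_esum => n _; rewrite esumZl//; last first.
    by move=> v; rewrite lee_fin prodr_ge0.
  by rewrite (IH (fun j => u (lift ord0 j)))// muleC.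
rewrite esumZl//; last by move=> n; rewrite lee_fin.
by rewrite big_ord_recl -[X in (_ * X)%E]fineK// -EFinM mulrC.
Qed.

Variable d : nat.
Implicit Types (l : 'rV[R]_d) (k : 'rV[int]_d).

Lemma gauss_periodizationE l (t : d.-tuple (measurableTypeR R)) :
  Lambda l -> unit_cube t ->
  gauss_periodization l (tvec t) = \prod_j theta (l ord0 j) (tvec t ord0 j).
Proof.
move=> l0 t01; rewrite /gauss_periodization.
rewrite (eq_esum (b := fun n : 'rV[int]_d =>
    (\prod_j gauss1 (l ord0 j) (tvec t ord0 j + (n ord0 j)%:~R))%:E)); last first.
  by move=> n _; rewrite /gauss; congr EFin; apply: eq_bigr => j _; rewrite !mxE.
rewrite (@esum_rV_prod d (fun j n => gauss1 (l ord0 j) (tvec t ord0 j + n%:~R)))//.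
- by move=> j n; exact: gauss1_ge0.
- move=> j; apply: esum_gauss1_fin; first exact: l0.
  by have := t01 j; rewrite in_itv mxE.
Qed.

(** The identity between Fourier coefficients of a periodization and values of the Fourier transform
    at integer points, in real form. It factors over the coordinates into the one-dimensional
    coefficients of [theta]. *)
Lemma gauss_periodization_coef l k : Lambda l ->
  [/\ tint (fun x => gauss_periodization l x * cos (phase k x)),
     tint (fun x => gauss_periodization l x * sin (phase k x)),
     tor (fun x => gauss_periodization l x * cos (phase k x)) = gauss_hat l (zvec k) &
     tor (fun x => gauss_periodization l x * sin (phase k x)) = 0].
Proof.
move=> l0.
have [] := @tor_prod R d (fun j => theta (l ord0 j)) k.
- by move=> j; apply: integrable_theta; exact: l0.
- by move=> j; apply: Rintegral_theta_sin; exact: l0.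
move=> ic is' tc ts.
have E (h : R -> R) t : unit_cube t ->
    gauss_periodization l (tvec t) * h (phase k (tvec t)) =
    \prod_j theta (l ord0 j) (tvec t ord0 j) * h (phase k (tvec t)).
  by move=> t01; rewrite gauss_periodizationE.
split.
- by apply: eq_integrable ic => [|t /set_mem t01]; [exact: measurable_cube|rewrite (E cos)].
- by apply: eq_integrable is' => [|t /set_mem t01];
    [exact: measurable_cube|rewrite (E sin)].
- transitivity (tor (fun x => \prod_j theta (l ord0 j) (x ord0 j) * cos (phase k x))).
    by apply: eq_Rintegral => t /set_mem t01; rewrite (E cos).
  by rewrite tc; apply: eq_bigr => j _; rewrite Rintegral_theta_cos ?mxE//; exact: l0.
- rewrite -[RHS]ts.
  by apply: eq_Rintegral => t /set_mem t01; rewrite (E sin).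
Qed.

End gauss_periodization_product.

(** * Continuous functions and characters on the fundamental domain *)

Section continuous_on_cube.
Context {R : realType} {d : nat}.
Local Notation mR := (measurableTypeR R).
Implicit Types (F : 'rV[R]_d -> R) (k : 'rV[int]_d).

Lemma measurable_tvec_ball (x : 'rV[R]_d) (e : R) : 0 < e ->
    measurable (@tvec R d @^-1` ball x e).
Proof.
move=> e0.
have -> : @tvec R d @^-1` ball x e =
    \bigcap_(j in [set: 'I_d]) ((@tnth d mR)^~ j @^-1` ball (x ord0 j) e).
  apply/seteqP; split=> t /=.
    by move=> [_ h] j _; have := h ord0 j; rewrite mxE.
  move=> h; split => // i j; rewrite ord1 mxE; exact: h.
apply: fin_bigcap_measurable; first exact: finite_finset.
move=> j _; rewrite -[X in measurable X]setTI; apply: (measurable_tnth j) => //.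
exact: measurable_ball.
Qed.

(* [V] is the union of the countably many balls of rational data that it contains. *)
Lemma measurable_tvec_open (V : set 'rV[R]_d) : open V -> measurable (@tvec R d @^-1` V).
Proof.
move=> oV.
pose c (p : 'rV[rat]_d * nat) : 'rV[R]_d := map_mx ratr p.1.
pose r (p : 'rV[rat]_d * nat) : R := p.2.+1%:R^-1.
pose G (p : 'rV[rat]_d * nat) : set (d.-tuple mR) :=
  if `[< ball (c p) (r p) `<=` V >] then @tvec R d @^-1` ball (c p) (r p) else set0.
have -> : @tvec R d @^-1` V = \bigcup_p G p.
  apply/seteqP; split=> t; last first.
    by move=> [p _]; rewrite /G; case: asboolP => // h /h.
  move=> /= Vt; have /nbhs_ballP[e /= e0 eV] : nbhs (tvec t) V by exact: open_nbhs_nbhs.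
  (* With a radius below [e / 2], any ball whose centre is within that radius of [tvec t] stays
     inside [ball (tvec t) e]. *)
  have [n ne] : exists n : nat, n.+1%:R^-1 < e / 2.
    have e20 : 0 < e / 2 by rewrite divr_gt0.
    have /cvgrPdist_lt/(_ _ e20)[N _ /(_ N (leqnn N))] := @cvg_harmonic R.
    rewrite /= sub0r normrN ger0_norm//.
    by exists N.
  have n0 : 0 < n.+1%:R^-1 :> R by rewrite invr_gt0.
  have /choice[q hq] : forall j : 'I_d, exists q : rat,
      ratr q \in `](tvec t ord0 j - n.+1%:R^-1), (tvec t ord0 j + n.+1%:R^-1)[.
    by move=> j; apply: rat_in_itvoo; rewrite ltrD2l; apply: lt_trans n0; rewrite oppr_lt0.
  pose p : 'rV[rat]_d * nat := (\row_j q j, n).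
  have cp i j : ball (c p i j) (r p) (tvec t i j).
    have -> : i = ord0 by apply/val_inj; rewrite ord1.
    rewrite /ball/= /r/= distrC /c [map_mx _ _ _ _]mxE [X in ratr X]mxE.
    have := hq j; rewrite in_itv/= => /andP[h1 h2].
    move: h1 h2; rewrite !mxE; move: (n.+1%:R^-1) (tnth t j) (ratr (q j)) => w u v h1 h2.
    rewrite ltr_norml; apply/andP; split; lra.
  exists p => //; rewrite /G; case: asboolP => [_|nh]; first by split.
  exfalso; apply: nh => y [_ hy]; apply: eV; split => // i j.
  have := ball_triangle (ball_sym (cp i j)) (hy i j); apply: le_ball.
  by move: ne; rewrite /r/=; move: (n.+1%:R^-1) => w; lra.
apply: countable_bigcupT_measurable; first exact: countableP.
move=> p; rewrite /G; case: asboolP => // _; apply: measurable_tvec_ball.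
by rewrite /r invr_gt0.
Qed.

(** Links the two structures in play: integration uses the product sigma-algebra on tuples,
    continuity the topology of row vectors. *)
Lemma measurable_tvec_continuous F : continuous F ->
  measurable_fun setT (fun t : d.-tuple mR => F (tvec t)).
Proof.
move=> /continuousP cF; apply: (measurability _ (RGenOpens.measurableE R)).
move=> _ [_ [a [b ->] <-]]; rewrite setTI.
by apply: (@measurable_tvec_open (F @^-1` `]a, b[)); apply: cF; exact: interval_open.
Qed.

(** The half-open cube is not compact; on this closed one continuous functions attain their bounds.
    Its extra faces repeat points of the torus. *)
Definition ccube : set 'rV[R]_d := [set x | forall j, x ord0 j \in `[0, 1]].

Lemma compact_ccube : compact ccube.
Proof. exact: (@rV_compact R d (fun=> `[0, 1]%classic) (fun=> @segment_compact _ _ _)). Qed.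

Lemma cube_ccube t : unit_cube t -> ccube (tvec t).
Proof.
by move=> h j; rewrite mxE; have := h j; rewrite !in_itv/= => /andP[-> /ltW].
Qed.

Lemma bounded_ccube F : continuous F -> exists2 M, 0 <= M & forall x, ccube x ->
    `|F x| <= M.
Proof.
move=> cF.
have c0 : ccube !=set0 by exists 0 => j; rewrite mxE in_itv/= lexx ler01.
have cn : {within ccube, continuous (fun x => `|F x|)}.
  apply: continuous_subspaceT => x.
  by apply: (@continuous_comp _ _ _ F (fun y : R => `|y|));
      [exact: cF|exact: norm_continuous].
have [c _ h] := EVT_max_rV c0 compact_ccube cn.
by exists `|F c| => // x cx; apply: h; rewrite inE.
Qed.

Let Rintegral01 (f G : R -> R) : (forall x : R, is_derive x 1 G (f x)) -> continuous f ->
  \int[@lebesgue_measure R]_(x in `[0, 1[) f x = G 1 - G 0.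
Proof.
move=> dG cf.
have cG (x : R) : {for x, continuous G}.
  apply: differentiable_continuous; apply/derivable1_diffP.
  exact: (@ex_derive _ _ _ _ _ _ _ (dG x)).
rewrite /Rintegral integral_itv_bndo_bndc; last first.
  by apply/measurable_EFinP; apply: measurable_funTS; exact: continuous_measurable_fun.
rewrite (@continuous_FTC2 _ f G)//.
- exact: continuous_subspaceT.
- split.
  + by move=> x _; exact: (@ex_derive _ _ _ _ _ _ _ (dG x)).
  + by apply: cvg_at_right_filter; exact: cG.
  + by apply: cvg_at_left_filter; exact: cG.
- by move=> x _; rewrite derive1E; apply: derive_val.
Qed.

Let Rintegral01_cst (r : R) : \int[@lebesgue_measure R]_(x in `[0, 1[) r = r.
Proof.
have h (x : R) : is_derive x 1 (fun x => r * x) ((fun _ : R => r) x).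
  by have := @is_deriveZ R R R id r x 1 1 (is_derive_id x 1); rewrite /GRing.scale/= mulr1.
have c : continuous (fun _ : R => r) by move=> x; exact: cvg_cst.
by rewrite (Rintegral01 h c) mulr1 mulr0 subr0.
Qed.

(** The factor [1 *] gives the integrand the shape that [tor_prod] expects when all its factors are
    the constant 1. *)
Let Rintegral01_cos (n : int) :
  \int[@lebesgue_measure R]_(x in `[0, 1[) (1 * cos (2 * pi * (n%:~R * x))) = (n == 0)%:R.
Proof.
have [->|n0] := eqVneq n 0.
  by under eq_Rintegral do rewrite mul0r mulr0 cos0 mulr1; rewrite Rintegral01_cst.
have c0 : 2 * pi * n%:~R != 0 :> R.
  by rewrite !mulf_neq0// ?intr_eq0// gt_eqF// pi_gt0.
have c : continuous (fun x : R => 1 * cos (2 * pi * (n%:~R * x))).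
  have -> : (fun x : R => 1 * cos (2 * pi * (n%:~R * x))) = (fun x =>
      cos (2 * pi * (n%:~R * x) + 0)).
    by apply/funext => x; rewrite addr0 mul1r.
  exact: continuous_cosM.
have h (x : R) : is_derive x 1 (fun x => (2 * pi * n%:~R)^-1 * sin (2 * pi * (n%:~R * x) +
    0))
    (1 * cos (2 * pi * (n%:~R * x))).
  have h := is_derive_sinM n%:~R 0 x.
  rewrite (_ : (fun x => _) = ((2 * pi * n%:~R)^-1) *: (fun x =>
      sin (2 * pi * (n%:~R * x) + 0)))//.
  by apply: is_derive_eq; rewrite /GRing.scale/= ?mulNr ?mulrN ?opprK mulKf// addr0 mul1r.
rewrite (Rintegral01 h c) mulr1 mulr0 mulr0 !addr0 -[X in sin X]add0r sinD2piz.
by rewrite sin0 mulr0 subrr.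
Qed.

Let Rintegral01_sin (n : int) :
  \int[@lebesgue_measure R]_(x in `[0, 1[) (1 * sin (2 * pi * (n%:~R * x))) = 0.
Proof.
have [->|n0] := eqVneq n 0.
  by under eq_Rintegral do rewrite mul0r mulr0 sin0 mulr0; rewrite Rintegral01_cst.
have c0 : 2 * pi * n%:~R != 0 :> R.
  by rewrite !mulf_neq0// ?intr_eq0// gt_eqF// pi_gt0.
have c : continuous (fun x : R => 1 * sin (2 * pi * (n%:~R * x))).
  have -> : (fun x : R => 1 * sin (2 * pi * (n%:~R * x))) = (fun x =>
      sin (2 * pi * (n%:~R * x) + 0)).
    by apply/funext => x; rewrite addr0 mul1r.
  exact: continuous_sinM.
have h (x : R) : is_derive x 1 (fun x => - (2 * pi * n%:~R)^-1 * cos (2 * pi * (n%:~R * x)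
    + 0))
    (1 * sin (2 * pi * (n%:~R * x))).
  have h := is_derive_cosM n%:~R 0 x.
  rewrite (_ : (fun x => _) = (- (2 * pi * n%:~R)^-1) *: (fun x =>
      cos (2 * pi * (n%:~R * x) + 0)))//.
  by apply: is_derive_eq; rewrite /GRing.scale/= ?mulNr ?mulrN ?opprK mulKf// addr0 mul1r.
rewrite (Rintegral01 h c) mulr1 mulr0 mulr0 !addr0 -[X in cos X]add0r cosD2piz.
by rewrite subrr.
Qed.

Lemma tor_trig k :
  [/\ tint (fun x => cos (phase k x) : R), tint (fun x => sin (phase k x) : R),
     tor (fun x => cos (phase k x) : R) = (k == 0)%:R :> R &
     tor (fun x => sin (phase k x) : R) = 0 :> R].
Proof.
have m1 : (@lebesgue_measure R `[0%R, 1%R[%classic < +oo)%E.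
  by rewrite lebesgue_measure_itv/= lte01 oppr0 adde0 ltry.
have i1 : (@lebesgue_measure R).-integrable `[0, 1[ (EFin \o (fun=> (1 : R))).
  by apply: measurable_bounded_integrable => //; exact: bounded_cst.
have [] := @tor_prod R d (fun _ _ => 1) k (fun=> i1) (fun=> Rintegral01_sin _).
have E (h : R -> R) : (fun x => \prod_(j < d) (1 : R) * h (phase k x)) = (fun x =>
    h (phase k x)).
  by apply/funext => x; rewrite big1_eq mul1r.
rewrite !E => ic is' -> ->; split => //.
under eq_bigr do rewrite Rintegral01_cos.
have [->|k0] := eqVneq k 0; first by rewrite big1// => j _; rewrite mxE eqxx.
have [j kj] : exists j, k ord0 j != 0.
  apply/not_existsP => h; move/eqP: k0; apply; apply/rowP => j; rewrite mxE.
  by have := h j; case: eqP.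
by rewrite (bigD1 j)//= (negbTE kj) mul0r.
Qed.

Lemma phase0 (x : 'rV[R]_d) : phase 0 x = 0.
Proof. by rewrite /phase big1 ?mulr0// => j _; rewrite mxE mul0r. Qed.

Lemma tint1 : tint (fun _ : 'rV[R]_d => 1).
Proof.
have [+ _ _ _] := tor_trig 0; congr (tint _).
by apply/funext => x; rewrite phase0 cos0.
Qed.

Lemma tor1 : tor (fun _ : 'rV[R]_d => 1) = 1.
Proof.
have [_ _ h _] := tor_trig 0; rewrite eqxx in h; rewrite -[RHS]h; congr tor.
by apply/funext => x; rewrite phase0 cos0.
Qed.

Lemma tint_continuous F : continuous F -> tint F.
Proof.
move=> cF; have [M M0 FM] := bounded_ccube cF.
apply: (le_integrable measurable_cube _ _ (integrableZl measurable_cube M tint1)).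
  by apply/measurable_EFinP; apply: measurable_funTS; exact: measurable_tvec_continuous.
by move=> t /cube_ccube ct /=; rewrite lee_fin mulr1 (ger0_norm M0) FM.
Qed.

End continuous_on_cube.

(** * Extension of positive linear functionals *)

Section positive_extension.
Context {R : realType} {X : Type} (D : set X).
Implicit Types (S : set (X -> R)) (phi : (X -> R) -> R) (u v h e : X -> R).

(** The subspace and the functional are bundled so that one-step extensions can be iterated.
    Functions live on all of [X], while positivity is tested on [D] only. *)
Definition positive_linear S phi :=
  [/\ S (fun=> 0),
    forall (a : R) u v, S u -> S v -> S (fun x => a * u x + v x),
    forall (a : R) u v, S u -> S v -> phi (fun x => a * u x + v x) = a * phi u + phi v &
    forall u, S u -> (forall x, D x -> 0 <= u x) -> 0 <= phi u].

Lemma positive_linear0 S phi : positive_linear S phi -> phi (fun=> 0) = 0.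
Proof.
move=> [S0 _ lp _]; have := lp 1 _ _ S0 S0.
rewrite (_ : (fun=> _) = (fun=> 0)); last by apply/funext => x; rewrite mul1r addr0.
by rewrite mul1r => /eqP; rewrite -subr_eq0 opprD addrA subrr sub0r oppr_eq0 => /eqP.
Qed.

Lemma positive_linearZ S phi a u : positive_linear S phi -> S u ->
  S (fun x => a * u x) /\ phi (fun x => a * u x) = a * phi u.
Proof.
move=> pl Su; have [S0 Sl lp _] := pl.
have E : (fun x => a * u x + 0) = (fun x => a * u x) by apply/funext => x; rewrite addr0.
have := Sl a _ _ Su S0; have := lp a _ _ Su S0.
by rewrite E (positive_linear0 pl) addr0.
Qed.

Lemma positive_linear_sum S phi (I : Type) (r : seq I) (f : I -> X -> R) :
  positive_linear S phi -> (forall i, S (f i)) ->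
  S (fun x => \sum_(i <- r) f i x) /\
  phi (fun x => \sum_(i <- r) f i x) = \sum_(i <- r) phi (f i).
Proof.
move=> pl Sf; have [S0 Sl lp _] := pl; elim: r => [|i r [IH1 IH2]].
  have -> : (fun x => \sum_(i <- [::]) f i x) = (fun=> 0) by apply/funext => x;
      rewrite big_nil.
  by rewrite big_nil (positive_linear0 pl).
have -> : (fun x => \sum_(i <- i :: r) f i x) =
    (fun x => 1 * f i x + (\sum_(i <- r) f i x)).
  by apply/funext => x; rewrite big_cons mul1r.
by rewrite big_cons lp// IH2 mul1r; split => //; apply: Sl.
Qed.

(* [h] is sent to the supremum of [phi] over the minorants of [h] in [S]. *)
Let extension_step S phi h e : positive_linear S phi -> S e ->
  (forall x, D x -> `|h x| <= e x) ->
  exists S' phi', [/\ positive_linear S' phi', S `<=` S', S' h & {in S, phi' =1 phi}].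
Proof.
move=> pl Se he; have [S0 Sl lp pos] := pl.
have [Sh|nSh] := pselect (S h); first by exists S, phi; split.
have SZ a u := (@positive_linearZ _ _ a u pl).
have mono u v : S u -> S v -> (forall x, D x -> u x <= v x) -> phi u <= phi v.
  move=> Su Sv uv; rewrite -subr_ge0 addrC -mulN1r -lp//.
  by apply: pos => [|x Dx]; [exact: Sl|rewrite mulN1r addrC subr_ge0 uv].
pose Lo := [set r | exists2 u, S u /\ (forall x, D x -> u x <= h x) & r = phi u].
(* Domination by [e] works on both sides: [- e] is a minorant of [h] in [S], and [phi e] will bound
   [Lo] from above. *)
have Lo0 : Lo !=set0.
  exists (phi (fun x => -1 * e x)), (fun x => -1 * e x) => //.
  split; first by have [] := SZ (-1) _ Se.
  by move=> x Dx; have := he _ Dx; rewrite mulN1r ler_norml => /andP[].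
have LoU w : S w -> (forall x, D x -> h x <= w x) -> ubound Lo (phi w).
  move=> Sw hw _ [u [Su uh] ->]; apply: mono => // x Dx.
  by rewrite (le_trans (uh _ Dx))// hw.
have LoUe : has_ubound Lo.
  exists (phi e); apply: LoU => // x Dx.
  by have := he _ Dx; rewrite ler_norml => /andP[].
pose g := sup Lo.
have gU w : S w -> (forall x, D x -> h x <= w x) -> g <= phi w.
  by move=> Sw hw; apply: ge_sup => //; exact: LoU.
have gL u : S u -> (forall x, D x -> u x <= h x) -> phi u <= g.
  by move=> Su uh; apply: ub_le_sup => //; exists u.
pose dec v (p : R * (X -> R)) := S p.2 /\ v = (fun x => p.1 * h x + p.2 x).
(* Two different coefficients of [h] would express [h] through elements of [S], against [nSh].
   Uniqueness is what makes [phi'] independent of the choice made in its definition. *)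
have dec_uniq v p q : dec v p -> dec v q -> p = q.
  move=> [Sp vp] [Sq vq].
  have E x : (p.1 - q.1) * h x = -1 * p.2 x + q.2 x.
    have : p.1 * h x + p.2 x = q.1 * h x + q.2 x.
      by have := congr1 (@^~ x) vp; rewrite vq => ->.
    lra.
  have pq1 : p.1 = q.1.
    apply/eqP; rewrite -subr_eq0; apply/eqP; apply: contrapT => /eqP pq.
    apply: nSh; have [+ _] := SZ (p.1 - q.1)^-1 _ (Sl (-1) _ _ Sp Sq).
    by congr S; apply/funext => x; rewrite -E mulKf.
  rewrite [p]surjective_pairing [q]surjective_pairing pq1; congr pair.
  by apply/funext => x; have := E x; rewrite pq1 subrr mul0r; lra.
pose S' := [set v | exists p, dec v p].
pose phi' v := if pselect (exists p, dec v p) is left P then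
  (projT1 (cid P)).1 * g + phi (projT1 (cid P)).2 else 0.
have phi'E v p : dec v p -> phi' v = p.1 * g + phi p.2.
  move=> vp; rewrite /phi'; case: pselect => [P|nP]; last by exfalso; apply: nP; exists p.
  by case: cid => q /= vq; rewrite (dec_uniq _ _ _ vq vp).
have decS u : S u -> dec u (0, u).
  by move=> Su; split => //; apply/funext => x; rewrite mul0r add0r.
have dec_lin a u v p q : dec u p -> dec v q ->
    dec (fun x => a * u x + v x) (a * p.1 + q.1, fun x => a * p.2 x + q.2 x).
  move=> [Sp ->] [Sq ->]; split; first exact: Sl.
  by apply/funext => x /=; ring.
exists S', phi'; split.
- split.
  + by exists (0, fun=> 0); apply: decS.
  + by move=> a u v [p up] [q vq]; exists (a * p.1 + q.1, fun x => a * p.2 x + q.2 x);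
      exact: dec_lin.
  + move=> a u v [p up] [q vq].
    rewrite (phi'E _ _ up) (phi'E _ _ vq) (phi'E _ _ (dec_lin a _ _ _ _ up vq))/=.
    by rewrite lp; [ring|have [] := up|have [] := vq].
  + move=> v [[r u] vru] v0; rewrite (phi'E _ _ vru)/=; have [/= Su vE] := vru.
    have {}v0 x : D x -> 0 <= r * h x + u x by move=> /v0; rewrite vE.
    (* Dividing [0 <= r * h + u] by [- r] makes [(- r)^-1 * u] a majorant of [h] on [D] when [r < 0]
       and a minorant when [r > 0]; [gU] and [gL] then compare it with [g]. *)
    have [r0|r0|r0] := ltgtP r 0.
    * have [Sw ->] : S (fun x => (- r)^-1 * u x) /\ phi u = - r * phi (fun x =>
        (- r)^-1 * u x).
        have [Sw Ew] := SZ (- r)^-1 _ Su; split; first exact: Sw.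
        by rewrite Ew mulVKf// oppr_eq0 lt_eqF.
      rewrite mulNr -mulrBr nmulr_rge0// subr_le0; apply: gU => // x /v0 h0.
      rewrite mulrC ler_pdivlMr ?oppr_gt0//; have := h0; lra.
    * have [Sw ->] : S (fun x => (- r)^-1 * u x) /\ phi u = - r * phi (fun x =>
        (- r)^-1 * u x).
        have [Sw Ew] := SZ (- r)^-1 _ Su; split; first exact: Sw.
        by rewrite Ew mulVKf// oppr_eq0 gt_eqF.
      rewrite mulNr -mulrBr pmulr_rge0// subr_ge0; apply: gL => // x /v0 h0.
      rewrite invrN mulNr mulrC -mulNr ler_pdivrMr//; lra.
    * by rewrite r0 mul0r add0r; apply: pos => // x /v0; rewrite r0 mul0r add0r.
- by move=> u Su; exists (0, u); exact: decS.
- exists (1, fun=> 0); split => //.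
  by apply/funext => x; rewrite mul1r addr0.
- by move=> u /set_mem Su; rewrite (phi'E _ _ (decS _ Su))/= mul0r add0r.
Qed.

(** A finite list needs only repeated one-step extensions, without Zorn's lemma. The dominating [e]
    remains available because each domain contains the previous one. *)
Lemma positive_extension S phi e (hs : seq (X -> R)) : positive_linear S phi -> S e ->
  (forall h, List.In h hs -> forall x, D x -> `|h x| <= e x) ->
  exists S' phi', [/\ positive_linear S' phi', S `<=` S',
    forall h, List.In h hs -> S' h & {in S, phi' =1 phi}].
Proof.
move=> pl Se; elim: hs => [|h hs IH] hse; first by exists S, phi; split.
have [S1 [phi1 [pl1 SS1 hs1 E1]]] := IH (fun h' hh' => hse h' (or_intror hh')).
have [S2 [phi2 [pl2 SS2 h2 E2]]] := extension_step pl1 (SS1 _ Se) (hse h (or_introl erefl)).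
exists S2, phi2; split => //.
- exact: subset_trans SS2.
- by move=> h' [<-//|/hs1/SS2].
- move=> u Su; rewrite E2 ?E1//.
  by apply/mem_set/SS1/set_mem.
Qed.

End positive_extension.

(** * Trigonometric sums *)

Section torus_integral_linear.
Context {R : realType} {d : nat}.
Implicit Types (F G : 'rV[R]_d -> R).

Lemma tint_lin (a b : R) F G : tint F -> tint G ->
  tint (fun x => a * F x + b * G x) /\
  tor (fun x => a * F x + b * G x) = a * tor F + b * tor G.
Proof.
move=> iF iG.
have iaF := integrableZl measurable_cube a iF.
have ibG := integrableZl measurable_cube b iG.
split; first exact: (integrableD measurable_cube iaF ibG).
rewrite /tor RintegralD//; [|exact: measurable_cube].
by rewrite !RintegralZl//; exact: measurable_cube.
Qed.

Lemma tint_sum (I : Type) (s : seq I) (f : I -> 'rV[R]_d -> R) :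
  (forall i, tint (f i)) ->
  tint (fun x => \sum_(i <- s) f i x) /\
  tor (fun x => \sum_(i <- s) f i x) = \sum_(i <- s) tor (f i).
Proof.
move=> fi; elim: s => [|i s [IH1 IH2]].
  have -> : (fun x => \sum_(i <- [::]) f i x) = (fun x => 0 * 1 + 0 * 1 : R).
    by apply/funext => x; rewrite big_nil !mul0r addr0.
  have [? ->] := tint_lin 0 0 (@tint1 R d) (@tint1 R d).
  by split => //; rewrite big_nil !mul0r addr0.
have -> : (fun x => \sum_(i <- i :: s) f i x) =
    (fun x => 1 * f i x + 1 * \sum_(i <- s) f i x).
  by apply/funext => x; rewrite big_cons !mul1r.
have [? ->] := tint_lin 1 1 (fi i) IH1.
by split => //; rewrite !mul1r big_cons IH2.
Qed.

Lemma tor_le F G : tint F -> tint G -> (forall t, unit_cube t ->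
    F (tvec t) <= G (tvec t)) ->
  tor F <= tor G.
Proof. by move=> iF iG FG; apply: le_Rintegral => //; exact: measurable_cube. Qed.

End torus_integral_linear.

Section trigonometric_span.
Context {R : realType} {d : nat}.
Implicit Types (k : 'rV[int]_d) (x y : 'rV[R]_d) (T : 'rV[R]_d -> R).

(** A frequency may occur several times, and [k] along with [- k]; addition is then concatenation,
    at the price of non-unique coefficients. *)
Definition trig_sum (s : seq ('rV[int]_d * (R * R))) x : R :=
  \sum_(p <- s) (p.2.1 * cos (phase p.1 x) + p.2.2 * sin (phase p.1 x)).

Definition trig_span T := exists s, T = trig_sum s.

Lemma phaseD k k' x : phase (k + k') x = phase k x + phase k' x.
Proof.
rewrite /phase -mulrDr -big_split/=; congr (_ * _); apply: eq_bigr => j _.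
by rewrite mxE intrD mulrDl.
Qed.

Lemma phaseN k x : phase (- k) x = - phase k x.
Proof.
rewrite /phase -mulrN -sumrN; congr (_ * _); apply: eq_bigr => j _.
by rewrite mxE mulrNz mulNr.
Qed.

Lemma phase_delta (j : 'I_d) x : phase (delta_mx ord0 j) x = 2 * pi * x ord0 j.
Proof.
rewrite /phase (bigD1 j)//= mxE !eqxx mul1r big1 ?addr0// => i ij.
by rewrite mxE eqxx (negbTE ij) mul0r.
Qed.

Lemma trig_spanD T T' : trig_span T -> trig_span T' -> trig_span (fun x => T x + T' x).
Proof.
by move=> [s ->] [s' ->]; exists (s ++ s'); apply/funext => x; rewrite /trig_sum big_cat.
Qed.

Lemma trig_span_term k (a b : R) :
  trig_span (fun x => a * cos (phase k x) + b * sin (phase k x)).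
Proof. by exists [:: (k, (a, b))]; apply/funext => x; rewrite /trig_sum big_seq1. Qed.

Lemma trig_span_cst (c : R) : trig_span (fun=> c).
Proof.
have := trig_span_term 0 c 0; congr trig_span; apply/funext => x.
by rewrite phase0 cos0 sin0 mulr1 mulr0 addr0.
Qed.

Lemma trig_span_sum (I : Type) (s : seq I) (T : I -> 'rV[R]_d -> R) :
  (forall i, trig_span (T i)) -> trig_span (fun x => \sum_(i <- s) T i x).
Proof.
move=> sT; elim: s => [|i s IH].
  have -> : (fun x => \sum_(i <- [::]) T i x) = (fun=> 0) by apply/funext => x;
      rewrite big_nil.
  exact: trig_span_cst.
have -> : (fun x => \sum_(i <- i :: s) T i x) = (fun x => T i x + \sum_(i <- s) T i x).
  by apply/funext => x; rewrite big_cons.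
exact: trig_spanD.
Qed.

(** The product-to-sum formulas place each product of two terms at the frequencies [k + k'] and
    [k - k']. *)
Lemma trig_spanM T T' : trig_span T -> trig_span T' -> trig_span (fun x => T x * T' x).
Proof.
move=> [s ->] [s' ->].
have -> : (fun x => trig_sum s x * trig_sum s' x) = (fun x =>
   \sum_(p <- s) \sum_(q <- s') ((p.2.1 * cos (phase p.1 x) + p.2.2 * sin (phase p.1 x)) *
     (q.2.1 * cos (phase q.1 x) + q.2.2 * sin (phase q.1 x)))).
  apply/funext => x; rewrite /trig_sum mulr_suml; apply: eq_bigr => p _.
  by rewrite mulr_sumr.
apply: trig_span_sum => -[k [a b]]; apply: trig_span_sum => -[k' [a' b']] /=.
have := trig_spanD (trig_span_term (k + k') (2^-1 * (a * a' - b * b')) (2^-1 * (a * b' +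
    b * a')))
   (trig_span_term (k - k') (2^-1 * (a * a' + b * b')) (2^-1 * (b * a' - a * b'))).
congr trig_span; apply/funext => x.
rewrite !phaseD phaseN !cosD !sinD cosN sinN.
by move: (cos (phase k x)) (cos (phase k' x)) (sin (phase k x)) (sin (phase k' x))
  => u u' v v'; field.
Qed.

Lemma trig_spanX T n : trig_span T -> trig_span (fun x => T x ^+ n).
Proof.
move=> sT; elim: n => [|n IH].
  have -> : (fun x => T x ^+ 0) = (fun=> 1) by apply/funext => x; rewrite expr0.
  exact: trig_span_cst.
have -> : (fun x => T x ^+ n.+1) = (fun x => T x * T x ^+ n).
  by apply/funext => x; rewrite exprS.
exact: trig_spanM.
Qed.

Lemma continuous_scalel (c : R) (F : 'rV[R]_d -> R) : continuous F ->
    continuous (fun x => c * F x).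
Proof.
by move=> cF x; apply: (@continuousM _ _ (fun=> c) F x); [exact: cst_continuous|exact: cF].
Qed.

Lemma continuous_add (F G : 'rV[R]_d -> R) : continuous F -> continuous G ->
  continuous (fun x => F x + G x).
Proof. by move=> cF cG x; apply: (@continuousD _ _ _ F G x); [exact: cF|exact: cG]. Qed.

Lemma continuous_phase k : continuous (phase k : 'rV[R]_d -> R).
Proof.
suff cs (r : seq 'I_d) : continuous (fun x : 'rV[R]_d =>
    \sum_(j <- r) (k ord0 j)%:~R * x ord0 j).
  by rewrite /phase; apply: continuous_scalel; exact: cs.
elim: r => [|j r IH].
  rewrite (_ : (fun _ => _) = (fun=> 0)); first exact: cst_continuous.
  by apply/funext => x; rewrite big_nil.
rewrite (_ : (fun _ => _) = (fun x : 'rV[R]_d => (k ord0 j)%:~R * x ord0 j +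
    \sum_(j <- r) (k ord0 j)%:~R * x ord0 j)).
  apply: continuous_add IH.
  by apply: (@continuous_scalel _ (fun x => x ord0 j)); exact: coord_continuous.
by apply/funext => x; rewrite big_cons.
Qed.

Lemma continuous_cos_phase k : continuous (fun x : 'rV[R]_d => cos (phase k x)).
Proof.
by move=> x; apply: (@continuous_comp _ _ _ (phase k) cos);
    [exact: continuous_phase|exact: continuous_cos].
Qed.

Lemma continuous_sin_phase k : continuous (fun x : 'rV[R]_d => sin (phase k x)).
Proof.
by move=> x; apply: (@continuous_comp _ _ _ (phase k) sin);
    [exact: continuous_phase|exact: continuous_sin].
Qed.

Lemma continuous_trig_term k (a b : R) :
  continuous (fun x => a * cos (phase k x) + b * sin (phase k x)).
Proof.
apply: continuous_add; apply: continuous_scalel.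
  exact: continuous_cos_phase.
exact: continuous_sin_phase.
Qed.

Lemma continuous_trig_span T : trig_span T -> continuous T.
Proof.
move=> [s ->] {T}; rewrite /trig_sum; elim: s => [|p s IH].
  rewrite (_ : (fun _ => _) = (fun=> 0)); first exact: cst_continuous.
  by apply/funext => x; rewrite big_nil.
rewrite (_ : (fun _ => _) = (fun y => (p.2.1 * cos (phase p.1 y) +
    p.2.2 * sin (phase p.1 y)) +
  \sum_(p <- s) (p.2.1 * cos (phase p.1 y) + p.2.2 * sin (phase p.1 y)))).
  by apply: continuous_add IH; exact: continuous_trig_term.
by apply/funext => y; rewrite big_cons.
Qed.


(** Stated through integrability rather than continuity of [F], so that it serves both the
    continuous [h] and the differences [D l] of the final argument. *)
Lemma tor_trig_sum s (F : 'rV[R]_d -> R) :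
  (forall k, tint (fun x => F x * cos (phase k x))) ->
  (forall k, tint (fun x => F x * sin (phase k x))) ->
  tint (fun x => F x * trig_sum s x) /\
  tor (fun x => F x * trig_sum s x) = \sum_(p <- s)
    (p.2.1 * tor (fun x => F x * cos (phase p.1 x)) + p.2.2 * tor (fun x =>
        F x * sin (phase p.1 x))).
Proof.
move=> ic is'.
pose f (p : 'rV[int]_d * (R * R)) (x : 'rV[R]_d) :=
  p.2.1 * (F x * cos (phase p.1 x)) + p.2.2 * (F x * sin (phase p.1 x)).
have fp p : tint (f p) /\ tor (f p) = p.2.1 * tor (fun x =>
    F x * cos (phase p.1 x)) + p.2.2 * tor (fun x => F x * sin (phase p.1 x)).
  exact: tint_lin.
have -> : (fun x => F x * trig_sum s x) = (fun x => \sum_(p <- s) f p x).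
  apply/funext => x; rewrite /trig_sum mulr_sumr; apply: eq_bigr => p _.
  by rewrite /f; ring.
have [i1 ->] := tint_sum s (fun p => (fp p).1); split => //.
by apply: eq_bigr => p _; rewrite (fp p).2.
Qed.

End trigonometric_span.

(** * Nonnegativity from tests against nonnegative trigonometric polynomials *)

Section concentration.
Context {R : realType} {d : nat}.
Local Notation mu := (@lebesgue_measure R).
Implicit Types (x y : 'rV[R]_d) (h : 'rV[R]_d -> R).

Let bernoulli (c : R) n : 0 <= c -> 1 + n%:R * c <= (1 + c) ^+ n.
Proof.
move=> c0; elim: n => [|n IH]; first by rewrite mul0r addr0 expr0.
rewrite exprS; apply: (@le_trans _ _ ((1 + c) * (1 + n%:R * c))); last first.
  by rewrite ler_wpM2l// addr_ge0.
have : 0 <= n%:R * c * c :> R by rewrite !mulr_ge0.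
rewrite -natr1; lra.
Qed.

(** The range of [s] is that of the difference between a coordinate in [[0, 1]] and one in [[0, 1[].
    For [0 < t < 1] the half-angle formula gives [cos (2 * pi * t) = 1 - 2 * sin (pi * t) ^+ 2 <
    1]. *)
Let cos_eq1 (s : R) : -1 < s <= 1 -> cos (2 * pi * s) = 1 -> exists n : int, s = n%:~R.
Proof.
move=> /andP[s1 s2] c1.
have pos t : 0 < t < 1 -> cos (2 * pi * t) != 1 :> R.
  move=> /andP[t0 t1]; have : 0 < sin (pi * t).
    by apply: sin_gt0_pi; rewrite mulr_gt0 ?pi_gt0// gtr_pMr ?pi_gt0.
  move=> st; have -> : 2 * pi * t = (pi * t) *+ 2 by move: pi => p; ring.
  rewrite cos_mulr2n cos2sin2; apply/eqP => h.
  have : 0 < sin (pi * t) ^+ 2 by rewrite exprn_gt0.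
  by move: h; rewrite mulr2n; lra.
have [s0|s0|->] := ltgtP s 0; last by exists 0.
  have := pos (- s); rewrite mulrN cosN c1 eqxx => h.
  by have : false by apply: h; apply/andP; split; lra.
have [s11|s11] := ltP s 1; last by exists 1; apply/eqP; rewrite eq_le s2 s11.
have := pos s; rewrite c1 eqxx => h.
by have : false by apply: h; apply/andP; split.
Qed.

(* At most [2 * d], with equality exactly on [y + Z^d]. *)
Definition bump y x : R := \sum_(j < d) (cos (2 * pi * (x ord0 j - y ord0 j)) + 1).

Lemma trig_span_bump y : trig_span (bump y).
Proof.
rewrite /bump; apply: trig_span_sum => j; apply: trig_spanD; last exact: trig_span_cst.
have := @trig_span_term _ _ (delta_mx ord0 j) (cos (2 * pi * y ord0 j)) (sin (2 * pi * y
    ord0 j)).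
congr trig_span; apply/funext => x.
by rewrite phase_delta mulrBr cosB mulrC [in RHS]mulrC; congr (_ + _); rewrite mulrC.
Qed.

Lemma bump_ge0 y x : 0 <= bump y x.
Proof. by apply: sumr_ge0 => j _; rewrite -lerBlDr sub0r cos_geN1. Qed.

Lemma bump_le y x : bump y x <= (d * 2)%:R.
Proof.
rewrite natrM mulr_natl -[X in _ *+ X]card_ord -sumr_const; apply: ler_sum => j _.
by have := cos_le1 (2 * pi * (x ord0 j - y ord0 j)); lra.
Qed.

Lemma bump_refl y : bump y y = (d * 2)%:R.
Proof.
rewrite natrM mulr_natl -[X in _ *+ X]card_ord -sumr_const; apply: eq_bigr => j _.
by rewrite subrr mulr0 cos0.
Qed.

(** Equality forces every cosine to be 1. A point on a far face of the closed cube can be a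
    nontrivial translate of [y], hence the conclusion modulo integer vectors. *)
Lemma bump_eq y x (t : d.-tuple (measurableTypeR R)) : y = tvec t -> unit_cube t ->
    ccube x ->
  bump y x = (d * 2)%:R -> exists n : 'rV[int]_d, x = y + zvec n.
Proof.
move=> yt t01 cx bx.
have c1 j : cos (2 * pi * (x ord0 j - y ord0 j)) = 1.
  apply/eqP; rewrite eq_le cos_le1/=; apply: contrapT => /negP; rewrite -ltNge => lt1.
  have : bump y x < (d * 2)%:R.
    rewrite natrM mulr_natl -[X in _ *+ X]card_ord -sumr_const.
    rewrite /bump (bigD1 j)//= [X in _ < X](bigD1 j)//= ltr_leD//; first by lra.
    apply: ler_sum.
    by move=> i _; have := cos_le1 (2 * pi * (x ord0 i - y ord0 i)); lra.
  by rewrite bx ltxx.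
have /choice[n hn] : forall j, exists n : int, x ord0 j - y ord0 j = n%:~R.
  move=> j; apply: cos_eq1 (c1 j).
  have := cx j; have := t01 j; rewrite yt mxE !in_itv/= => /andP[? ?] /andP[? ?].
  by apply/andP; split; lra.
exists (\row_j n j); apply/rowP => j; rewrite !mxE -hn; lra.
Qed.


(** The indicator of a ball, written as a product over coordinates so that [tor_prod] at frequency 0
    computes its integral. *)
Let ind (y : 'rV[R]_d) (e : R) x : R := \prod_(j < d) \1_(ball (y ord0 j) e) (x ord0 j).

Let ind_tor (y : 'rV[R]_d) (e : R) (t : d.-tuple (measurableTypeR R)) :
  y = tvec t -> unit_cube t -> 0 < e -> tint (ind y e) /\ 0 < tor (ind y e).
Proof.
move=> yt t01 e0.
have m1 : (@lebesgue_measure R `[0%R, 1%R[%classic < +oo)%E.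
  by rewrite lebesgue_measure_itv/= lte01 oppr0 adde0 ltry.
have i1 j : mu.-integrable `[0, 1[ (EFin \o \1_(ball (y ord0 j) e)).
  apply: measurable_bounded_integrable => //.
    by apply: measurable_funTS; apply: measurable_indic; exact: measurable_ball.
  exists 1; split; [exact: num_real|move=> M M1 x _ /=].
  by rewrite indicE (le_trans _ (ltW M1))//; case: (_ \in _); rewrite ?normr1 ?normr0.
have [|ii _ ti _] := @tor_prod R d (fun j => \1_(ball (y ord0 j) e)) 0 i1.
  move=> j; rewrite mxE; under eq_Rintegral do rewrite mul0r mulr0 sin0 mulr0.
  by rewrite Rintegral_cst ?mul0r.
have E : (fun x => ind y e x * cos (phase 0 x)) = ind y e.
  by apply/funext => x; rewrite phase0 cos0 mulr1.
rewrite -E; split; first exact: ii.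
rewrite ti; apply: prodr_gt0 => j _; rewrite mxE.
under eq_Rintegral do rewrite mul0r mulr0 cos0 mulr1.
have /andP[y0 y1] : 0 <= y ord0 j < 1 by rewrite yt mxE; have := t01 j; rewrite in_itv.
rewrite /Rintegral integral_indic//; last exact: measurable_ball.
(* Since [y ord0 j < 1], the interval from [y ord0 j] to [b] is nondegenerate and lies both in the
   ball and in [[0, 1[], even when [y ord0 j = 0]. *)
pose b := Num.min (y ord0 j + e) 1.
have b1 : b <= 1 by rewrite ge_min lexx orbT.
have b2 : b <= y ord0 j + e by rewrite ge_min lexx.
have yb : y ord0 j < b by rewrite lt_min y1 ltrDl e0.
have sub : `[y ord0 j, b[%classic `<=` ball (y ord0 j) e `&` `[0, 1[.
  move=> z /=; rewrite !in_itv/= => /andP[z1 z2]; split.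
    rewrite /ball/= ltr_norml; apply/andP; split; lra.
  apply/andP; split; lra.
have mb : measurable (ball (y ord0 j) e `&` `[0, 1[).
  by apply: measurableI => //; exact: measurable_ball.
have lt1 : (0 < @lebesgue_measure R `[y ord0 j, b[%classic)%E.
  by rewrite lebesgue_measure_itv/= lte_fin yb -EFinB lte_fin subr_gt0.
rewrite -lte_fin fineK.
  apply: (lt_le_trans lt1).
  by apply: le_measure; rewrite ?inE.
rewrite ge0_fin_numE//; apply: le_lt_trans (ltry (e *+ 2)).
rewrite -(lebesgue_measure_ball (y ord0 j) (ltW e0)).
by apply: le_measure; rewrite ?inE//; exact: measurable_ball.
Qed.

Let nonneg_cube h (t : d.-tuple (measurableTypeR R)) : continuous h -> zperiodic h ->
  (forall T, trig_span T -> (forall x, 0 <= T x) -> 0 <= tor (fun x => h x * T x)) ->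
  unit_cube t -> 0 <= h (tvec t).
Proof.
move=> ch hper hT t01; rewrite leNgt; apply/negP => hy.
pose y := tvec t; pose eps := - h y / 2.
have eps0 : 0 < eps by rewrite divr_gt0// oppr_gt0.
pose D : R := (d * 2)%:R.
have D0 : 0 <= D by rewrite ler0n.
have cb : continuous (bump y) by apply/continuous_trig_span/trig_span_bump.
(* A gap given by compactness: where [- eps <= h] there is no translate of [y], because [h] is
   periodic and [h y = - 2 * eps], so the maximum of [bump y] there is below [D]. The bound
   [eta <= 1] keeps [N0] positive below. *)
have [eta /andP[eta0 eta1] Keta] : exists2 eta : R, 0 < eta <= 1 &
    forall x, ccube x -> - eps <= h x -> bump y x <= D - eta.
  pose K := ccube `&` h @^-1` [set z | - eps <= z].
  have [K0|/set0P K0] := eqVneq K set0.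
    exists 1; rewrite ?ltr01 ?lexx// => x cx hx.
    by have : K x by []; rewrite K0.
  have cK : compact K.
    apply: compact_closedI; first exact: compact_ccube.
    apply: (@closed_comp _ _ h) => [x _|]; [exact: ch|exact: closed_ge].
  have [c /set_mem[cc hc] cmax] := EVT_max_rV K0 cK (continuous_subspaceT cb).
  have cD : bump y c < D.
    rewrite lt_neqAle bump_le andbT; apply/eqP => bD.
    have [n cn] := bump_eq (erefl y) t01 cc bD.
    move: hc; rewrite /= cn hper -/y /eps; lra.
  exists (Num.min 1 (D - bump y c)).
    by rewrite lt_min ltr01 subr_gt0 cD ge_min lexx.
  move=> x cx hx; have : bump y x <= bump y c by apply: cmax; rewrite inE.
  have : Num.min 1 (D - bump y c) <= D - bump y c by rewrite ge_min lexx orbT.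
  lra.
have [e /= e0 be] : exists2 e : R, 0 < e & forall x, ball y e x -> D - eta / 4 < bump y x.
  have : \forall x \near y, D - eta / 4 < bump y x.
    apply: (@cvgr_gt _ _ _ (nbhs_filter y) (bump y) (bump y y) (cb y)).
    rewrite bump_refl -/D; lra.
  by move=> /nbhs_ballP[e /= e0 he]; exists e.
have [M M0 hM] := bounded_ccube ch.
(* [r] is nonnegative, at most 1 where [- eps <= h], and at least [1 + kappa]
   near [y], so that [r ^+ n] concentrates where [h < - eps]. *)
pose N0 := D + 1 - eta / 2.
have N00 : 0 < N0 by rewrite /N0; lra.
pose r x := N0^-1 * (bump y x + 1).
have rspan : trig_span r.
  have := trig_spanM (trig_span_cst N0^-1) (trig_spanD (trig_span_bump y) (trig_span_cst
      1)).
  exact.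
have r0 x : 0 <= r x by rewrite mulr_ge0 ?invr_ge0 ?(ltW N00)// addr_ge0 ?bump_ge0.
(* [N0] exceeds the far bound [D + 1 - eta] of [bump y x + 1] and falls short of its near bound
   [D + 1 - eta / 4] by [eta / 4]; relative to [N0] this margin is [kappa]. *)
pose kappa := (eta / 4) / N0.
have kappa0 : 0 < kappa by rewrite divr_gt0//; lra.
have rnear x : ball y e x -> 1 + kappa <= r x.
  move=> /be bx; rewrite /r [leRHS]mulrC ler_pdivlMr// mulrDl mul1r /kappa divfK ?gt_eqF//.
  by rewrite /N0; lra.
have rfar x : ccube x -> - eps <= h x -> r x <= 1.
  move=> cx /(Keta _ cx) Kx; rewrite /r mulrC ler_pdivrMr// mul1r /N0; lra.
have [indt V0] := ind_tor (erefl y) t01 e0.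
pose b := ind y e; pose V := tor b.
have b01 x : (b x = 1 /\ ball y e x) \/ b x = 0.
  have [yx|nyx] := pselect (forall j, ball (y ord0 j) e (x ord0 j)).
    left; split.
      by rewrite /b /ind big1// => j _; rewrite indicE mem_set.
    by split => // i j; rewrite (ord1 i); exact: yx.
  right; have /existsNP[j nj] := nyx.
  by rewrite /b /ind (bigD1 j)//= indicE memNset// mul0r.
(* Pointwise, [h * r ^+ n] is at most [M] where [- eps <= h] (there [r <= 1] and [b = 0]), at most 0
   where [h < - eps], and at most [- eps * (1 + n * kappa)] where moreover [b = 1], by Bernoulli's
   inequality. *)
have main n : tor (fun x => h x * r x ^+ n) <= M - eps * (1 + n%:R * kappa) * V.
  have [i2 E2] := tint_lin M (- (eps * (1 + n%:R * kappa))) (@tint1 R d) indt.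
  have -> : M - eps * (1 + n%:R * kappa) * V = M * tor (fun _ : 'rV[R]_d => 1) +
      - (eps * (1 + n%:R * kappa)) * tor (ind y e) by rewrite tor1 mulr1 mulNr.
  rewrite -E2.
  have cr : continuous (fun x => h x * r x ^+ n).
    move=> x; apply: (@continuousM _ _ h (fun x => r x ^+ n) x); first exact: ch.
    exact: (continuous_trig_span (trig_spanX n rspan)).
  apply: tor_le => //; first exact: tint_continuous.
  move=> s /cube_ccube; move: (tvec s) => x cx; rewrite mulr1 -/(b x).
  have rn0 : 0 <= r x ^+ n by rewrite exprn_ge0.
  have [hx|hx] := leP (- eps) (h x).
    have r1 := rfar _ cx hx.
    have -> : b x = 0.
      have [[_ bx]|//] := b01 x.
      by have := rnear _ bx; lra.
    rewrite mulr0 addr0 (le_trans (ler_norm _))// normrM (ger0_norm rn0).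
    apply: (@le_trans _ _ (`|h x| * 1)); last by rewrite mulr1 hM.
    by rewrite ler_wpM2l// exprn_ile1.
  have hr : h x * r x ^+ n <= - eps * r x ^+ n by rewrite ler_wpM2r// ltW.
  apply: (le_trans hr).
  have [[-> bx]|->] := b01 x; last first.
    by rewrite mulr0 addr0 (le_trans _ M0)// mulNr oppr_le0 mulr_ge0// ltW.
  have h1 : 1 + n%:R * kappa <= r x ^+ n.
    apply: (le_trans (bernoulli n (ltW kappa0))).
    by rewrite lerXn2r ?rnear// ?nnegrE ?r0// addr_ge0// ltW.
  rewrite mulr1 mulNr.
  have : eps * (1 + n%:R * kappa) <= eps * r x ^+ n by rewrite ler_wpM2l// ltW.
  lra.
have ekV : 0 < eps * kappa * V by apply: mulr_gt0 => //; apply: mulr_gt0.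
(* Chosen so that [n.+1 * (eps * kappa * V) > M], which makes the bound [main n.+1] negative. *)
pose n := Num.truncn (M / (eps * kappa * V)).
have := hT _ (trig_spanX n.+1 rspan) (fun x => exprn_ge0 n.+1 (r0 x)).
rewrite leNgt => /negP; apply; apply: le_lt_trans (main n.+1) _.
have := truncnS_gt (M / (eps * kappa * V)); rewrite -/n ltr_pdivrMr//.
have : 0 < eps * V by apply: mulr_gt0.
move: (n.+1%:R) => w; lra.
Qed.

Lemma nonneg_of_trig_span h : continuous h -> zperiodic h ->
  (forall T, trig_span T -> (forall x, 0 <= T x) -> 0 <= tor (fun x => h x * T x)) ->
  forall x, 0 <= h x.
Proof.
move=> ch hper hT x.
pose n : 'rV[int]_d := \row_j (- Num.floor (x ord0 j)).
pose t : d.-tuple (measurableTypeR R) := [tuple (x ord0 j + (n ord0 j)%:~R : R) | j < d].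
have tx : tvec t = x + zvec n by apply/rowP => j; rewrite !mxE tnth_mktuple mxE.
rewrite -(hper x n) -tx; apply: nonneg_cube => // j.
rewrite tnth_mktuple in_itv/= mxE intrN.
have /andP[] := floor_itv (x ord0 j); rewrite intrD => h1 h2.
by apply/andP; split; lra.
Qed.

End concentration.

(** * Real form of trigonometric polynomials of given degree *)

Section fourier_coefficients.
Context {R : realType} {d : nat}.
Implicit Types (k n : 'rV[int]_d) (a : 'rV[int]_d) (F : 'rV[R]_d -> R).

(** Adding [w] codes an integer of absolute value below [w] as a natural number below [w + w]; this
    bounds the number of frequencies. *)
Let abs_shift (u v : int) (w : nat) : `|u| < v -> (`|v|%N <= w)%N ->
  (`|u - - w%:Z|%N < w + w)%N /\ u = `|u - - w%:Z|%N%:Z - w%:Z.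
Proof. lia. Qed.

Lemma finite_freq_lt a : finite_set (freq_lt a).
Proof.
pose B := (\sum_j `|a ord0 j|)%N.
pose e (f : {ffun 'I_d -> 'I_(B + B)}) : 'rV[int]_d := \row_j ((f j)%:Z - B%:Z).
apply: (@sub_finite_set _ _ (e @` setT)).
  move=> n na.
  have aB j : (`|a ord0 j|%N <= B)%N by rewrite /B (bigD1 j)//= leq_addr.
  exists [ffun j => Ordinal (abs_shift (na j) (aB j)).1] => //; apply/rowP => j.
  by rewrite mxE ffunE/=; exact/esym/(abs_shift (na j) (aB j)).2.
by apply: finite_image; exact: finite_finset.
Qed.

Lemma freq_ltN a n : freq_lt a (- n) <-> freq_lt a n.
Proof. by split=> h j; have := h j; rewrite mxE normrN. Qed.

(** The cosine does not distinguish [k] from [- k], so both cases count; for [n = k = 0] they add up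
    to 1. *)
Lemma tor_cos_cos n k :
  tor (fun x => cos (phase n x) * cos (phase k x)) =
  2^-1 * ((n == - k)%:R + (n == k)%:R) :> R.
Proof.
have [i1 _ t1 _] := @tor_trig R d (n + k); have [i2 _ t2 _] := @tor_trig R d (n - k).
have [_ E] := tint_lin 2^-1 2^-1 i1 i2.
rewrite t1 t2 -mulrDr subr_eq0 addr_eq0 in E; rewrite -E; congr tor; apply/funext => x.
by rewrite !phaseD phaseN !cosD cosN sinN; field.
Qed.

Lemma tor_sin_sin n k :
  tor (fun x => sin (phase n x) * sin (phase k x)) =
  2^-1 * ((n == k)%:R - (n == - k)%:R) :> R.
Proof.
have [i1 _ t1 _] := @tor_trig R d (n + k); have [i2 _ t2 _] := @tor_trig R d (n - k).
have [_ E] := tint_lin (- 2^-1) 2^-1 i1 i2.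
rewrite t1 t2 subr_eq0 addr_eq0 in E.
rewrite (_ : 2^-1 * _ = - 2^-1 * (n == - k)%:R + 2^-1 * (n == k)%:R); last by ring.
rewrite -E; congr tor; apply/funext => x.
by rewrite !phaseD phaseN !cosD cosN sinN; field.
Qed.

Lemma tor_sin_cos n k : tor (fun x => sin (phase n x) * cos (phase k x)) = 0 :> R.
Proof.
have [_ i1 _ t1] := @tor_trig R d (n + k); have [_ i2 _ t2] := @tor_trig R d (n - k).
have [_ E] := tint_lin 2^-1 2^-1 i1 i2.
rewrite t1 t2 !mulr0 addr0 in E; rewrite -[RHS]E; congr tor; apply/funext => x.
by rewrite !phaseD phaseN !sinD cosN sinN; field.
Qed.

Lemma tint_trigM (T : 'rV[R]_d -> R) F : continuous T -> continuous F -> tint (fun x =>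
    F x * T x).
Proof.
move=> cT cF; apply: tint_continuous => x.
by apply: (@continuousM _ _ F T x); [exact: cF|exact: cT].
Qed.

Lemma fourier_coefE F k : fourier_coef F k =
  (tor (fun x => F x * cos (phase k x)) +i* tor (fun x => F x * - sin (phase k x)))%C.
Proof.
rewrite /fourier_coef /torus_Cintegral /tor /torus_integral /Rintegral.
by congr (fine _ +i* fine _)%C; apply: eq_integral => t _; congr EFin;
  rewrite /expi2pi -/(phase _ _) phaseN cosN sinN /= ?mul0r ?subr0 ?addr0.
Qed.

(** For a symmetric duplicate-free [r], an even [c] and an odd [s], the Fourier coefficient at [n]
    in [r] is [c n - i * s n], with no factor 2. *)
Definition cossin_sum (r : seq 'rV[int]_d) (c s : 'rV[int]_d -> R) :=
  @trig_sum R d [seq (n, (c n, s n)) | n <- r].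

Lemma cossin_sumE r c s x :
  cossin_sum r c s x = \sum_(n <- r) (c n * cos (phase n x) + s n * sin (phase n x)).
Proof. by rewrite /cossin_sum /trig_sum big_map. Qed.

Lemma tor_cossin_sum r c s F : continuous F ->
  tor (fun x => F x * cossin_sum r c s x) =
  \sum_(n <- r) (c n * tor (fun x => F x * cos (phase n x)) + s n * tor (fun x =>
      F x * sin (phase n x))).
Proof.
move=> cF.
have [_ ->] := @tor_trig_sum R d [seq (n, (c n, s n)) | n <- r] F
  (fun k => tint_trigM (continuous_cos_phase (k:=k)) cF) (fun k =>
      tint_trigM (continuous_sin_phase (k:=k)) cF).
by rewrite big_map.
Qed.

Let sum_delta (r : seq 'rV[int]_d) (f : 'rV[int]_d -> R) j : uniq r ->
  \sum_(n <- r) f n * (n == j)%:R = if j \in r then f j else 0.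
Proof.
move=> ur; rewrite (eq_bigr (fun n => if n == j then f n else 0)); last first.
  by move=> n _; case: eqP; rewrite ?mulr1 ?mulr0.
rewrite -big_mkcond/=; case: ifPn => jr; first by rewrite (big_rem j)//= eqxx big1_seq
    ?addr0// => i /andP[/eqP -> ]; rewrite mem_rem_uniq// inE eqxx.
by rewrite big1_seq// => i /andP[/eqP -> ij]; rewrite ij in jr.
Qed.

(** The entries [k] and [- k] of the symmetric list contribute [c k / 2] each; for [k = 0] the
    single entry contributes both halves. *)
Lemma tor_cossin_sum_cos r c s k : uniq r -> (forall n, (- n \in r) = (n \in r)) ->
  (forall n, c (- n) = c n) ->
  tor (fun x => cossin_sum r c s x * cos (phase k x)) = if k \in r then c k else 0.
Proof.
move=> ur rN cN.
rewrite (_ : tor _ = tor (fun x => cos (phase k x) * cossin_sum r c s x)); last first.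
  by congr tor; apply/funext => x; rewrite mulrC.
rewrite tor_cossin_sum; last exact: continuous_cos_phase.
transitivity (\sum_(n <- r) 2^-1 * (c n * (n == - k)%:R + c n * (n == k)%:R)).
  apply: eq_bigr => n _; rewrite tor_cos_cos.
  rewrite [X in s n * X](_ : _ = 0).
    by rewrite mulr0 addr0 [k == - n]eq_sym [k == n]eq_sym eqr_oppLR; ring.
  by rewrite -[RHS](tor_sin_cos n k); congr tor; apply/funext => x; rewrite mulrC.
rewrite -mulr_sumr big_split/= !sum_delta// rN cN.
by case: ifP => _; rewrite ?addr0 ?mulr0//; field.
Qed.

Lemma tor_cossin_sum_sin r c s k : uniq r -> (forall n, (- n \in r) = (n \in r)) ->
  (forall n, s (- n) = - s n) ->
  tor (fun x => cossin_sum r c s x * sin (phase k x)) = if k \in r then s k else 0.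
Proof.
move=> ur rN sN.
rewrite (_ : tor _ = tor (fun x => sin (phase k x) * cossin_sum r c s x)); last first.
  by congr tor; apply/funext => x; rewrite mulrC.
rewrite tor_cossin_sum; last exact: continuous_sin_phase.
transitivity (\sum_(n <- r) 2^-1 * (s n * (n == k)%:R - s n * (n == - k)%:R)).
  apply: eq_bigr => n _; rewrite tor_sin_sin tor_sin_cos mulr0 add0r.
  by rewrite [k == - n]eq_sym [k == n]eq_sym eqr_oppLR; ring.
rewrite -mulr_sumr sumrB !sum_delta// rN sN.
by case: ifP => _; rewrite ?subr0 ?mulr0//; field.
Qed.

Lemma freq_lt_seq a : exists r : seq 'rV[int]_d,
  [/\ uniq r, freq_lt a = [set` r] & forall n, (- n \in r) = (n \in r)].
Proof.
have /finite_seqP[r ar] := finite_freq_lt a.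
have memr n : n \in undup r <-> freq_lt a n by rewrite mem_undup ar.
exists (undup r); split; first exact: undup_uniq.
  by apply/seteqP; split => n /memr.
by move=> n; apply/idP/idP => /memr/freq_ltN/memr.
Qed.

Lemma complex_sum (r : seq 'rV[int]_d) (u v : 'rV[int]_d -> R) :
  \sum_(n <- r) (u n +i* v n)%C = ((\sum_(n <- r) u n) +i* (\sum_(n <- r) v n))%C.
Proof.
elim: r => [|n r IH]; first by rewrite !big_nil.
by rewrite !big_cons IH; apply/eqP; rewrite eq_complex /= !eqxx.
Qed.

Lemma trigpoly_lt_cossin_sum a r c s : uniq r -> freq_lt a = [set` r] ->
  (forall n, (- n \in r) = (n \in r)) ->
  (forall n, c (- n) = c n) -> (forall n, s (- n) = - s n) ->
  trigpoly_lt a (cossin_sum r c s).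
Proof.
move=> ur ar rN cN sN x.
rewrite ar -fsbig_seq//.
pose Z := \sum_(n <- r) (c n * sin (phase n x) - s n * cos (phase n x)).
rewrite (eq_big_seq (fun n => (c n * cos (phase n x) + s n * sin (phase n x)) +i*
   (c n * sin (phase n x) - s n * cos (phase n x)))%C); last first.
  move=> n nr; rewrite fourier_coefE (tor_cossin_sum_cos _ _ ur rN cN) nr.
  rewrite (_ : tor _ = - s n).
    rewrite /expi2pi -/(phase n x); apply/eqP; rewrite eq_complex /=.
    by apply/andP; split; apply/eqP; ring.
  have := tor_cossin_sum_sin c (- n) ur rN sN; rewrite rN nr sN => <-.
  by congr tor; apply/funext => y; rewrite phaseN sinN.
rewrite complex_sum cossin_sumE -/Z; suff -> : Z = 0 by [].
(* [Z] is the imaginary part of the complex sum; its summand is odd in [n] and [r] is symmetric. *)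
have ZN : Z = - Z.
  rewrite -sumrN {1}/Z (perm_big (map -%R r))/=; last first.
    apply: uniq_perm; [by []|by rewrite map_inj_uniq//; exact: oppr_inj|].
    move=> n; apply/idP/mapP => [nr|[m mr ->]]; last by rewrite rN.
    by exists (- n); rewrite ?opprK ?rN.
  rewrite big_map; apply: eq_bigr => n _.
  by rewrite cN sN phaseN sinN cosN; ring.
by move: ZN; lra.
Qed.

Lemma torN F : tint F -> tor (fun x => - F x) = - tor F.
Proof.
move=> iF; have [_ E] := tint_lin (-1) 0 iF iF.
rewrite mul0r addr0 mulN1r in E; rewrite -E; congr tor; apply/funext => x.
by rewrite mul0r addr0 mulN1r.
Qed.

Lemma continuous_cossin_sum r c s : continuous (cossin_sum r c s).
Proof. by apply: continuous_trig_span; eexists. Qed.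

(** [trigpoly_lt] expands [P] with its own coefficients, so the real part of that expansion is
    already a [cossin_sum]. *)
Lemma trigpoly_lt_cossin a r (P : 'rV[R]_d -> R) : uniq r -> freq_lt a = [set` r] ->
  trigpoly_lt a P ->
  exists c s, [/\ P = cossin_sum r c s, forall n, c (- n) = c n & forall n,
      s (- n) = - s n].
Proof.
move=> ur ar hP.
pose c n := tor (fun x => P x * cos (phase n x)).
pose s n := - tor (fun x => P x * - sin (phase n x)).
have PE : P = cossin_sum r c s.
  apply/funext => x; have := hP x; rewrite ar -fsbig_seq// cossin_sumE.
  rewrite (eq_bigr (fun n => (c n * cos (phase n x) + s n * sin (phase n x)) +i*
    (c n * sin (phase n x) - s n * cos (phase n x)))%C); last first.
    move=> n _; rewrite fourier_coefE /expi2pi -/(phase n x) -/(c n).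
    rewrite (_ : tor _ = - s n); last by rewrite /s opprK.
    by apply/eqP; rewrite eq_complex /=; apply/andP; split; apply/eqP; ring.
  by rewrite complex_sum => /(congr1 (@complex.Re R)).
(* Continuity follows from the expansion just obtained and supplies the integrability that [torN]
   asks for. *)
have cP : continuous P by rewrite PE; exact: continuous_cossin_sum.
exists c, s; split => // n.
  by rewrite /c; congr tor; apply/funext => x; rewrite phaseN cosN.
rewrite /s opprK -torN; last first.
  apply: (@tint_trigM (fun x => - sin (phase (- n) x))) => // x.
  by apply: continuousN; exact: continuous_sin_phase.
by congr tor; apply/funext => x; rewrite phaseN sinN opprK mulrN.
Qed.

Lemma trigpoly_lt_coef0 a (P : 'rV[R]_d -> R) k : trigpoly_lt a P -> ~ freq_lt a k ->
  tor (fun x => P x * cos (phase k x)) = 0 /\ tor (fun x => P x * sin (phase k x)) = 0.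
Proof.
move=> hP nk; have [r [ur ar rN]] := freq_lt_seq a.
have [c [s [-> cN sN]]] := trigpoly_lt_cossin ur ar hP.
have kr : (k \in r) = false by apply/negP => kr; apply: nk; rewrite ar.
by rewrite tor_cossin_sum_cos// tor_cossin_sum_sin// kr.
Qed.

Lemma continuous_trigpoly_lt a (P : 'rV[R]_d -> R) : trigpoly_lt a P -> continuous P.
Proof.
move=> hP; have [r [ur ar rN]] := freq_lt_seq a.
by have [c [s [-> _ _]]] := trigpoly_lt_cossin ur ar hP; exact: continuous_cossin_sum.
Qed.

Lemma phase_zvec k n x : exists z : int, phase k (x + zvec n) =
    phase k x + 2 * pi * z%:~R :> R.
Proof.
exists (\sum_j k ord0 j * n ord0 j); rewrite /phase -mulrDr
  (big_morph (fun z : int => z%:~R : R) (@intrD R) (mulr0z 1)) -big_split/=.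
by congr (_ * _); apply: eq_bigr => j _; rewrite !mxE mulrDr intrM.
Qed.

Lemma zperiodic_cossin_sum r c s : zperiodic (cossin_sum r c s).
Proof.
move=> x n; rewrite !cossin_sumE; apply: eq_bigr => k _.
by have [z ->] := phase_zvec k n x; rewrite cosD2piz sinD2piz.
Qed.

End fourier_coefficients.

Lemma mem_In (T : eqType) (x : T) (s : seq T) : x \in s -> List.In x s.
Proof. by elim: s => //= y s IH; rewrite inE => /orP[/eqP->|/IH]; [left|right]. Qed.

(** * The majorant *)

Section majorant.
Context {R : realType} {d : nat}.
Variables (a : 'rV[int]_d) (P : 'rV[R]_d -> 'rV[R]_d -> R).
Hypothesis hP : forall l, Lambda l -> trigpoly_lt a (P l).
Variable nu : {measure set (borel_rV R d) -> \bar R}.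
Hypothesis hmeas : measurable_fun (Lambda : set (borel_rV R d)) (L1_error P).
Hypothesis hfin : (total_error nu P < +oo)%E.
Variable g : 'rV[R]_d -> R.
Hypotheses (hg : continuous g) (hper : zperiodic g).
Hypothesis hghat : forall k : 'rV[int]_d, (exists j, a ord0 j <= `|k ord0 j|) ->
  nu.-integrable Lambda (fun l => (gauss_hat l (zvec k))%:E) /\
  fourier_coef g k = (\int[nu]_(l in Lambda) gauss_hat l (zvec k))%:C.
Variable sigma : R.
Hypothesis sigma2 : sigma * sigma = 1.
Hypothesis hsigma : forall x l, Lambda l -> 0 <= sigma * (P l x - gauss_periodization l x).

Local Notation Lam := (Lambda : set (borel_rV R d)).

Let D l x := sigma * (P l x - gauss_periodization l x).

(* The value 0 off [Lambda] makes [B (- k) = - B k] hold everywhere, where [D l]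
   need not be integrable. *)
Let A k l := if `[< Lambda l >] then tor (fun x => D l x * cos (phase k x)) else 0.
Let B k l := if `[< Lambda l >] then tor (fun x => D l x * sin (phase k x)) else 0.

Let measurable_Lambda : measurable Lam.
Proof.
have -> : Lam = \bigcap_(j in [set: 'I_d]) [set l : borel_rV R d | 0 < (l : 'rV[R]_d) ord0
    j].
  by apply/seteqP; split=> l h; [move=> j _; exact: h|move=> j; exact: h].
apply: fin_bigcap_measurable; first exact: finite_finset.
move=> j _; apply: sub_sigma_algebra.
apply: (@open_comp _ _ (fun l : 'rV[R]_d => l ord0 j) [set y | 0 < y]); last exact: open_gt.
by move=> l _; exact: coord_continuous.
Qed.

Let DA k l : Lambda l -> [/\ tint (fun x => D l x * cos (phase k x)),
  A k l = sigma * (tor (fun x => P l x * cos (phase k x)) - gauss_hat l (zvec k)),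
  tint (fun x => D l x * sin (phase k x)) &
  B k l = sigma * tor (fun x => P l x * sin (phase k x))].
Proof.
move=> Ll; have cP := continuous_trigpoly_lt (hP Ll).
have ic := tint_trigM (@continuous_cos_phase R d k) cP.
have is' := tint_trigM (@continuous_sin_phase R d k) cP.
have [gic gis gtc gts] := gauss_periodization_coef k Ll.
have [i1 E1] := tint_lin sigma (- sigma) ic gic.
have [i2 E2] := tint_lin sigma (- sigma) is' gis.
have Ec : (fun x => D l x * cos (phase k x)) = (fun x => sigma * (P l x * cos (phase k x)) +
    - sigma * (gauss_periodization l x * cos (phase k x))).
  by apply/funext => x; rewrite /D; ring.
have Es : (fun x => D l x * sin (phase k x)) = (fun x => sigma * (P l x * sin (phase k x)) +
    - sigma * (gauss_periodization l x * sin (phase k x))).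
  by apply/funext => x; rewrite /D; ring.
rewrite Ec Es; split => //.
  by rewrite /A asboolT// Ec E1 gtc; ring.
by rewrite /B asboolT// Es E2 gts; ring.
Qed.

Let tintD l : Lambda l -> tint (D l).
Proof.
move=> Ll; have [+ _ _ _] := DA 0 Ll; congr tint.
by apply/funext => x; rewrite phase0 cos0 mulr1.
Qed.

Let A0 l : Lambda l -> A 0 l = tor (D l).
Proof.
move=> Ll; rewrite /A asboolT//; congr tor.
by apply/funext => x; rewrite phase0 cos0 mulr1.
Qed.

Let sigma1 : `|sigma| = 1.
Proof.
by apply/eqP; rewrite -sqrp_eq1// expr2 -normrM sigma2 normr1.
Qed.

(** As [D l >= 0] and [|sigma| = 1], the absolute error is [D l] itself. This identifies the
    coefficient [A 0] with an integrable function. *)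
Let L1E l : Lambda l -> L1_error P l = (A 0 l)%:E.
Proof.
move=> Ll; rewrite A0// /tor /Rintegral fineK; last first.
  by apply: integrable_fin_num (tintD Ll); exact: measurable_cube.
apply: eq_integral => t _; rewrite -/(tvec t); congr EFin.
by rewrite -[RHS]ger0_norm ?hsigma// normrM sigma1 mul1r.
Qed.

(** Because [D l >= 0], a weight of absolute value at most 1 cannot push the integral beyond the
    mean. This makes [A 0] the dominating function for the extension. *)
Let bound (w : 'rV[R]_d -> R) l : Lambda l -> (forall x, `|w x| <= 1) ->
  tint (fun x => D l x * w x) -> `|tor (fun x => D l x * w x)| <= A 0 l.
Proof.
move=> Ll w1 iw; rewrite A0//.
have iD := tintD Ll; have [iN EN] := tint_lin (-1) 0 iD iD.
rewrite mul0r addr0 mulN1r in EN.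
have D0 x : 0 <= D l x by exact: hsigma.
rewrite ler_norml; apply/andP; split.
  rewrite -EN; apply: tor_le => // t _; have := w1 (tvec t);
      rewrite ler_norml => /andP[w2 _].
  rewrite mul0r addr0 mulN1r -mulrN1; exact: ler_wpM2l.
apply: tor_le => // t _; have := w1 (tvec t); rewrite ler_norml => /andP[_ w2].
by rewrite -[leRHS]mulr1; exact: ler_wpM2l.
Qed.

Let boundA k l : Lambda l -> `|A k l| <= A 0 l.
Proof.
move=> Ll; have [i _ _ _] := DA k Ll; rewrite {1}/A asboolT//; apply: bound => // x.
by rewrite ler_norml cos_geN1 cos_le1.
Qed.

Let boundB k l : Lambda l -> `|B k l| <= A 0 l.
Proof.
move=> Ll; have [_ _ i _] := DA k Ll; rewrite {1}/B asboolT//; apply: bound => // x.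
by rewrite ler_norml sin_geN1 sin_le1.
Qed.

Let S : set ('rV[R]_d -> R) := [set u : 'rV[R]_d -> R | nu.-integrable Lam (EFin \o u)].
Let phi (u : 'rV[R]_d -> R) : R := \int[nu]_(l in Lam) u l.

Let positive_linear_integral : positive_linear Lambda S phi.
Proof.
have Sl c u v : S u -> S v -> S (fun x => c * u x + v x).
  move=> Su Sv.
  exact: (integrableD measurable_Lambda (integrableZl measurable_Lambda c Su) Sv).
split => //.
- exact: integrable0.
- move=> c u v Su Sv; rewrite /phi RintegralD//; first by rewrite RintegralZl.
  exact: (integrableZl measurable_Lambda c Su).
- by move=> u Su u0; apply: Rintegral_ge0 => x; exact: u0.
Qed.

Let SA0 : S (A 0).
Proof.
have E : {in Lam, L1_error P =1 EFin \o A 0} by move=> l /set_mem /L1E.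
have I0 : nu.-integrable Lam (L1_error P).
  apply/integrableP; split; first exact: hmeas.
  apply: le_lt_trans hfin; rewrite le_eqVlt; apply/orP; left; apply/eqP.
  apply: eq_integral => l /set_mem Ll.
  by rewrite L1E// gee0_abs// lee_fin (le_trans _ (boundA 0 Ll)).
exact: eq_integrable I0.
Qed.

Let phiA0 : (phi (A 0))%:E = total_error nu P.
Proof.
rewrite /phi /Rintegral fineK; last exact: integrable_fin_num.
by apply: eq_integral => l /set_mem Ll; rewrite L1E.
Qed.

(** Off the band [P l] contributes nothing: [A k] reduces to [- sigma * gauss_hat], integrable by
    [hghat], and [B k] to 0, in agreement with the coefficient of [g] being real. *)
Let coef_large k : ~ freq_lt a k ->
  [/\ S (A k), S (B k), phi (A k) = - sigma * tor (fun x => g x * cos (phase k x)) &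
      phi (B k) = - sigma * tor (fun x => g x * sin (phase k x))].
Proof.
move=> nk.
have [j kj] : exists j, a ord0 j <= `|k ord0 j|.
  by move/existsNP : nk => [j /negP]; rewrite -leNgt => ?; exists j.
have [ig] := hghat (ex_intro _ j kj).
rewrite fourier_coefE => /eqP; rewrite eq_complex/= => /andP[/eqP gc /eqP gs].
have {}gs : tor (fun x => g x * sin (phase k x)) = 0.
  apply/eqP; rewrite -oppr_eq0 -torN; last exact/tint_trigM/hg/continuous_sin_phase.
  by apply/eqP; rewrite -[RHS]gs; congr tor; apply/funext => x; rewrite mulrN.
have AE l : Lambda l -> A k l = - sigma * gauss_hat l (zvec k).
  move=> Ll; have [_ -> _ _] := DA k Ll.
  by have [-> _] := trigpoly_lt_coef0 (hP Ll) nk; rewrite sub0r mulrN mulNr.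
have BE l : Lambda l -> B k l = 0.
  move=> Ll; have [_ _ _ ->] := DA k Ll.
  by have [_ ->] := trigpoly_lt_coef0 (hP Ll) nk; rewrite mulr0.
split.
- apply: eq_integrable (integrableZl measurable_Lambda (- sigma) ig) => // l /set_mem Ll.
  by rewrite /= AE// EFinM.
- apply: eq_integrable (integrable0 _ _) => // l /set_mem Ll.
  by rewrite /= BE.
- rewrite gc -RintegralZl//; apply: eq_Rintegral => l /set_mem Ll; exact: AE.
- rewrite gs mulr0 -[RHS](mul0r (fine (nu Lam))) -Rintegral_cst//.
  by apply: eq_Rintegral => l /set_mem Ll; exact: BE.
Qed.

Lemma signed_majorant : exists m : 'rV[R]_d -> R,
  [/\ trigpoly_lt a m, forall x, 0 <= sigma * (m x - g x) &
    torus_integral (fun x => sigma * (m x - g x)) = total_error nu P].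
Proof.
have [r [ur ar rN]] := freq_lt_seq a.
have hs_bound h : List.In h (map A r ++ map B r) -> forall l, Lambda l -> `|h l| <= A 0 l.
  move=> hh l Ll.
  by have [h1|h1] := List.in_app_or _ _ _ hh; have [k [<- _]] :=
      (List.in_map_iff _ _ _).1 h1;
    [exact: boundA|exact: boundB].
have [S' [Phi [pl SS' hS' PhiE]]] :=
  positive_extension positive_linear_integral SA0 hs_bound.
have inr k : k \in r -> List.In k r by exact: mem_In.
have nfreq k : k \notin r -> ~ freq_lt a k by rewrite ar => /negP.
have SA k : S' (A k).
  have [kr|/nfreq/coef_large[SAk _ _ _]] := boolP (k \in r); last exact: SS'.
  by apply: hS'; apply/List.in_or_app; left; apply: List.in_map; exact: inr.
have SB k : S' (B k).
  have [kr|/nfreq/coef_large[_ SBk _ _]] := boolP (k \in r); last exact: SS'.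
  by apply: hS'; apply/List.in_or_app; right; apply: List.in_map; exact: inr.
have AN k : A (- k) = A k.
  apply/funext => l; rewrite /A; case: asboolP => // _; congr tor.
  by apply/funext => x; rewrite phaseN cosN.
have BN k : B (- k) = (fun l => -1 * B k l).
  apply/funext => l; rewrite mulN1r {2}/B /B; case: asboolP => [Ll|_];
      last by rewrite oppr0.
  have [_ _ i _] := DA k Ll; rewrite -torN//; congr tor.
  by apply/funext => x; rewrite phaseN sinN mulrN.
(* Solved from the requirement that [h = sigma * (m - g)] have coefficients [Phi (A k)] and
   [Phi (B k)] on the band, using [sigma * sigma = 1]. *)
pose c k := sigma * Phi (A k) + tor (fun x => g x * cos (phase k x)).
pose s k := sigma * Phi (B k) + tor (fun x => g x * sin (phase k x)).
have cN k : c (- k) = c k.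
  rewrite /c AN; congr (_ + tor _).
  by apply/funext => x; rewrite phaseN cosN.
have sN k : s (- k) = - s k.
  rewrite /s BN (positive_linearZ (-1) pl (SB k)).2 mulN1r mulrN opprD; congr (_ + _).
  rewrite -torN; last exact/tint_trigM/hg/continuous_sin_phase.
  by congr tor; apply/funext => x; rewrite phaseN sinN mulrN.
pose m := cossin_sum r c s : 'rV[R]_d -> R.
have cm : continuous m by exact: continuous_cossin_sum.
pose h x := sigma * m x + (- sigma) * g x.
have hE x : h x = sigma * (m x - g x) by rewrite /h; ring.
have ch : continuous h.
  by apply: continuous_add; apply: continuous_scalel.
have ph : zperiodic h by move=> x n; rewrite /h hper /m zperiodic_cossin_sum.
have hcos k : tor (fun x => h x * cos (phase k x)) = Phi (A k).
  have [_ E] := tint_lin sigma (- sigma) (tint_trigM (@continuous_cos_phase R d k) cm)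
    (tint_trigM (@continuous_cos_phase R d k) hg).
  transitivity (tor (fun x => sigma * (m x * cos (phase k x)) +
      - sigma * (g x * cos (phase k x)))).
    by congr tor; apply/funext => x; rewrite /h; ring.
  rewrite E tor_cossin_sum_cos//; case: ifPn => [_|/nfreq/coef_large[SAk _ E1 _]].
    by rewrite /c mulrDr mulrA sigma2 mul1r mulNr addrK.
  by rewrite PhiE ?E1 ?mulr0 ?add0r//; exact/mem_set.
have hsin k : tor (fun x => h x * sin (phase k x)) = Phi (B k).
  have [_ E] := tint_lin sigma (- sigma) (tint_trigM (@continuous_sin_phase R d k) cm)
    (tint_trigM (@continuous_sin_phase R d k) hg).
  transitivity (tor (fun x => sigma * (m x * sin (phase k x)) +
      - sigma * (g x * sin (phase k x)))).
    by congr tor; apply/funext => x; rewrite /h; ring.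
  rewrite E tor_cossin_sum_sin//; case: ifPn => [_|/nfreq/coef_large[_ SBk _ E1]].
    by rewrite /s mulrDr mulrA sigma2 mul1r mulNr addrK.
  by rewrite PhiE ?E1 ?mulr0 ?add0r//; exact/mem_set.
(* For a nonnegative [T] the integral of [h T] is [Phi] applied to the function sending [l] to the
   integral of [D l T], a finite combination of the [A k] and [B k] that is nonnegative on
   [Lambda]. *)
have h0 x : 0 <= h x.
  apply: (nonneg_of_trig_span ch ph) => {x} _ [q ->] q0.
  have [_ ->] := @tor_trig_sum R d q h
    (fun k => tint_trigM (@continuous_cos_phase R d k) ch)
    (fun k => tint_trigM (@continuous_sin_phase R d k) ch).
  have [S'0 S'l Phil Phi0] := pl.
  pose f (p : 'rV[int]_d * (R * R)) l := p.2.1 * A p.1 l + p.2.2 * B p.1 l.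
  have Sf p : S' (f p) /\ Phi (f p) = p.2.1 * Phi (A p.1) + p.2.2 * Phi (B p.1).
    have [S1 E1] := positive_linearZ p.2.2 pl (SB p.1).
    by split; [exact: S'l|rewrite Phil// E1].
  have [Sq Eq] := positive_linear_sum q pl (fun p => (Sf p).1).
  rewrite (eq_bigr (fun p => Phi (f p))); last first.
    by move=> p _; rewrite hcos hsin (Sf p).2.
  rewrite -Eq; apply: Phi0 => // l Ll.
  have [iq Eq'] := @tor_trig_sum R d q (D l) (fun k => let: And4 i _ _ _ := DA k Ll in i)
    (fun k => let: And4 _ _ i _ := DA k Ll in i).
  rewrite (_ : \sum_(p <- q) f p l = tor (fun x => D l x * trig_sum q x)).
    by apply: Rintegral_ge0 => t _; rewrite mulr_ge0 ?q0//; exact: hsigma.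
  by rewrite Eq'; apply: eq_bigr => p _; rewrite /f /A /B asboolT.
exists m; split.
- exact: trigpoly_lt_cossin_sum.
- by move=> x; rewrite -hE.
(* [A 0] belongs to the original domain [S], so [Phi (A 0)] is the actual integral, and the mean of
   [h] equals the total error exactly. *)
- rewrite -phiA0 -(PhiE (A 0)); last exact/mem_set/SA0.
  rewrite -(hcos 0).
  have -> : (fun x => sigma * (m x - g x)) = h by apply/funext => x; rewrite hE.
  have -> : (fun x => h x * cos (phase 0 x)) = h.
    by apply/funext => x; rewrite phase0 cos0 mulr1.
  rewrite /tor /Rintegral fineK//.
  by apply: integrable_fin_num (tint_continuous ch); exact: measurable_cube.
Qed.

End majorant.

Theorem theorem15 (R : realType) (d : nat) (a : 'rV[int]_d)
  (ha : forall j, 1 <= a ord0 j)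
  (P : 'rV[R]_d -> 'rV[R]_d -> R)
  (hP : forall l, Lambda l -> trigpoly_lt a (P l))
  (nu : {measure set (borel_rV R d) -> \bar R})
  (hmeas : measurable_fun (Lambda : set (borel_rV R d))
     (L1_error P))
  (hfin : (total_error nu P < +oo)%E)
  (g : 'rV[R]_d -> R) (hg : continuous g) (hper : zperiodic g)
  (hghat : forall k : 'rV[int]_d, (exists j, a ord0 j <= `|k ord0 j|) ->
     nu.-integrable Lambda (fun l => (gauss_hat l (zvec k))%:E) /\
     fourier_coef g k = (\int[nu]_(l in Lambda) gauss_hat l (zvec k))%:C) :
  ((forall x l, Lambda l -> gauss_periodization l x <= P l x) ->
     exists m : 'rV[R]_d -> R,
       [/\ trigpoly_lt a m,
           forall x, g x <= m x &
           torus_integral (fun x => m x - g x) = total_error nu P]) /\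
  ((forall x l, Lambda l -> P l x <= gauss_periodization l x) ->
     exists b : 'rV[R]_d -> R,
       [/\ trigpoly_lt a b,
           forall x, b x <= g x &
           torus_integral (fun x => g x - b x) = total_error nu P]).
Proof.
split=> hPf.
- have [||m [mt m0 mi]] := @signed_majorant R d a P hP nu hmeas hfin g hg hper hghat 1.
  + by rewrite mulr1.
  + by move=> x l Ll; rewrite mul1r subr_ge0 hPf.
  exists m; split => //.
    by move=> x; have := m0 x; rewrite mul1r subr_ge0.
  rewrite -mi; congr torus_integral; apply/funext => x.
  by rewrite mul1r.
- have [||m [mt m0 mi]] := @signed_majorant R d a P hP nu hmeas hfin g hg hper hghat (-1).
  + by rewrite mulrN1 opprK.
  + by move=> x l Ll; rewrite mulN1r opprB subr_ge0 hPf.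
  exists m; split => //.
    by move=> x; have := m0 x; rewrite mulN1r opprB subr_ge0.
  rewrite -mi; congr torus_integral; apply/funext => x.
  by rewrite mulN1r opprB.
Qed.
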